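(* For any $k\le\frac n2$ let $T\in\mathbf{Tab}_{(n-k,k)}$ and let $\sigma_T=(i_1,b_1)\cdots(i_k,b_k)$. For any $a\in\langle T_1\rangle$ such that $a-1\in\langle T_2\rangle$ let $$B(a)=\bigl\{b_p\in\langle T_2\rangle\ :\ b_p<a,\ \text{and either } b_p=a-1\ \text{ or }\ \{b_p+1,b_p+2,\dots,a-1\}=\{i_q,b_q\}_{q>p}\bigr\}.$$ Then for any $b_p\in B(a)$, $\mathrm{Change}(T,a,b_p)$ is a Young tableau such that $$\operatorname{codim}_{\mathcal V_T}\bigl(\mathcal V_T\cap\mathcal V_{\mathrm{Change}(T,a,b_p)}\bigr)=1.$$
   Context: Work over $\mathbb C$. $\mathbf{Tab}_{(n-k,k)}$ is the set of Young tableaux with entries $1,\dots,n$ (each used once, increasing along rows and down columns) with two columns, the first of length $n-k$ and the second of length $k$. For such $T$, $\langle T_1\rangle$ and $\langle T_2\rangle$ are the sets of entries of its first and second column; write $\langle T_2\rangle=\{b_1<\dots<b_k\}$. Define the involution $\sigma_T=(i_1,b_1)\cdots(i_k,b_k)$, where $i_1=b_1-1$ and, for $s>1$, $i_s=\max\{d\in\langle T_1\rangle\setminus\{i_1,\dots,i_{s-1}\}: d<b_s\}$. The notation $\{i_q,b_q\}_{q>p}$ means the set of all entries $i_q,b_q$ with $p<q\le k$. For $i\in\langle T_1\rangle$, $j\in\langle T_2\rangle$, $\mathrm{Change}(T,i,j)$ is the two-column array, with entries increasing down each column, whose first column has entry set $\{j\}\cup\langle T_1\rangle\setminus\{i\}$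 and whose second column has entry set $\{i\}\cup\langle T_2\rangle\setminus\{j\}$ (it need not be a Young tableau in general). Orbital varieties: let $\mathfrak n$ be the space of strictly upper-triangular $n\times n$ matrices and $\mathcal O_{(n-k,k)}$ the $GL_n$-conjugacy class of matrices $x$ with $x^2=0$ and rank $k$. The orbital varieties associated to $\mathcal O_{(n-k,k)}$ are the irreducible components of $\mathcal O_{(n-k,k)}\cap\mathfrak n$; they are in bijection with $\mathbf{Tab}_{(n-k,k)}$, the component $\mathcal V_T$ being the closure in $\mathcal O_{(n-k,k)}\cap\mathfrak n$ of the set of $x\in\mathcal O_{(n-k,k)}\cap\mathfrak n$ such that for every $m$ the upper-left $m\times m$ block of $x$ has rank $\#\{b\in\langle T_2\rangle: b\le m\}$. Equivalently (known), $\mathcal V_T=\overline{\mathcal B}_{\sigma_T}\cap\mathcal O_{(n-k,k)}$, where $\mathcal B_{\sigma}$ is the orbit, under conjugation by invertible upper-triangular matrices, of the matrix $N_\sigma$ with $(N_\sigma)_{i,j}=1$ if $i<j$ and $\sigma(i)=j$, and $0$ otherwise, and the bar denotes Zariski closure. $\operatorname{codim}_{\mathcal V_T}(Y)=\dim\mathcal V_T-\dim Y$. *)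

(* Defs.v *)
From HB Require Import structures.
From mathcomp Require Import all_boot all_order all_algebra.
From mathcomp Require Import boolp classical_sets.
From mathcomp Require mpoly.

Set Implicit Arguments.
Unset Strict Implicit.
Unset Printing Implicit Defensive.

Import GRing.Theory.
Local Open Scope classical_set_scope.
Local Open Scope ring_scope.

Section Tableaux.
Local Open Scope nat_scope.

(* Two-column arrays; entries are the numbers 1, ..., n and each column is
   listed from top to bottom. *)
Definition array2 : Type := seq nat * seq nat.

Definition is_tableau (n k : nat) (T : array2) : Prop :=
  [/\ size T.1 = n - k, size T.2 = k, perm_eq (T.1 ++ T.2) (iota 1 n),
      sorted ltn T.1 /\ sorted ltn T.2
    & forall r, r < k -> nth 0 T.1 r < nth 0 T.2 r].

Definition Change (T : array2) (i j : nat) : array2 :=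
  (sort leq (j :: rem i T.1), sort leq (i :: rem j T.2)).

(* [avail] is the set of elements of the first column not used so far. *)
Fixpoint next_cycles (avail bs : seq nat) : seq (nat * nat) :=
  if bs is b :: bs' then
    let i := \max_(d <- avail | d < b) d in
    (i, b) :: next_cycles (rem i avail) bs'
  else [::].

(* The involution sigma_T, as the list of its 2-cycles (i_1, b_1), ...,
   (i_k, b_k) in this order. *)
Definition sigma (T : array2) : seq (nat * nat) :=
  if T.2 is b :: bs then (b.-1, b) :: next_cycles (rem b.-1 T.1) bs
  else [::].

(* The index p is 0-based here: b_(p+1) = nth 0 T.2 p, and [drop p.+1]
   keeps exactly the later cycles, up to the k-th one. *)
Definition Bset (T : array2) (a : nat) : set nat :=
  [set b | exists p, [/\ p < size T.2, b = nth 0 T.2 p, b < a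
    & b = a.-1 \/
      [set x | b.+1 <= x <= a.-1] =
      [set x | exists2 c, c \in drop p.+1 (sigma T) & x = c.1 \/ x = c.2]]].

End Tableaux.

Section Zariski.
Variables (F : fieldType) (m n : nat).
Implicit Types A Y Z : set 'M[F]_(m, n).

Definition poly_at (p : mpoly.mpoly (m * n)%N F) (x : 'M[F]_(m, n)) : F :=
  mpoly.meval (fun i => mxvec x 0 i) p.

Definition zariski_closed Z : Prop :=
  exists S : set (mpoly.mpoly (m * n)%N F),
    Z = [set x | forall p, S p -> poly_at p x = 0].

Definition zariski_closure A : set 'M[F]_(m, n) := smallest zariski_closed A.

Definition closed_in Y Z : Prop :=
  exists2 W, zariski_closed W & Z = W `&` Y.

Definition irreducible Z : Prop :=
  Z !=set0 /\
  forall A B, closed_in Z A -> closed_in Z B -> Z = A `|` B -> Z = A \/ Z = B.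

Definition irreducible_chain Y (d : nat) : Prop :=
  exists Z : nat -> set 'M[F]_(m, n),
    (forall i, (i <= d)%N -> closed_in Y (Z i) /\ irreducible (Z i)) /\
    (forall i, (i < d)%N -> Z i `<` Z i.+1).

(* Krull dimension for the induced Zariski topology; the empty set has none. *)
Definition has_dim Y (d : nat) : Prop :=
  irreducible_chain Y d /\ forall e, irreducible_chain Y e -> (e <= d)%N.

Definition has_codim Z Y (c : nat) : Prop :=
  exists d e : nat, [/\ has_dim Z d, has_dim Y e & d = (e + c)%N].

End Zariski.

Section OrbitalVarieties.
Variables (F : fieldType) (n : nat).

Definition strictly_upper : set 'M[F]_n :=
  [set x | forall i j : 'I_n, (j <= i)%N -> x i j = 0].

Definition nilp_orbit (k : nat) : set 'M[F]_n :=
  [set x | x *m x = 0 /\ \rank x = k].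

Definition orbital_cell (k : nat) (T : array2) : set 'M[F]_n :=
  [set x | (nilp_orbit k `&` strictly_upper) x /\
    forall (m : nat) (hm : (m <= n)%N),
      \rank (mxsub (widen_ord hm) (widen_ord hm) x)
      = count (fun b => (b <= m)%N) T.2].

Definition orbital_variety (k : nat) (T : array2) : set 'M[F]_n :=
  zariski_closure (orbital_cell k T) `&` (nilp_orbit k `&` strictly_upper).

End OrbitalVarieties.

Arguments orbital_variety : clear implicits.

(* Main.v *)
(** Encode a tableau by its set of pivots, the entries of its second column.
    The cell of a pivot set J consists of the matrices (1 - N) C (1 + N) with N
    strictly upper and supported on J x J^c, and C strictly upper of rank #|J|,
    supported on J^c x J.  Hence V_T is irreducible, and its dimension is at
    most the number k (n - k) of parameters: a chain of length e provides e
    functions that are algebraically independent on its last term, and there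
    are too few polynomials of bounded degree in fewer than e parameters.

    The cell of T' = Change T a b contains an explicit family with
    k (n - k) - 1 parameters, of matrices x = g C g^-1 where row b of C vanishes
    in the columns up to a, and column a of C vanishes in the rows from b on.
    Then g (1 + t E) C (1 - t E) g^-1, with E = delta_mx a b, lies in the cell
    of T for t <> 0 and tends to x, so that x lies in both varieties.  Freeing
    the parameters one by one in a suitable order gives a chain of length
    k (n - k) - 1 in the intersection.  As V_T is irreducible and not contained
    in V_T', adding V_T to a chain of the intersection makes it one step longer,
    so both dimensions are determined. *)

Require Import Defs.
From mathcomp Require Import all_boot all_order all_algebra.
From mathcomp Require Import boolp classical_sets reals.
From mathcomp.real_closed Require Import complex.
From mathcomp Require Import -(notations) mpoly.
From mathcomp Require Import zify ring.

Set Implicit Arguments.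
Unset Strict Implicit.
Unset Printing Implicit Defensive.

Import Order.TTheory GRing.Theory Num.Theory.
Local Open Scope ring_scope.

(** * Polynomial functions *)

Section PolynomialFunctions.
Variables (F : fieldType) (m n : nat).
Implicit Types f g : 'M[F]_(m, n) -> F.

(** The index is only an upper bound for the degree, which is what the counting argument needs.
    Functions are used instead of formal polynomials, so that composition and restriction to a line
    are immediate. *)
Inductive poly_deg : nat -> ('M[F]_(m, n) -> F) -> Prop :=
| poly_deg_cst d c : poly_deg d (fun=> c)
| poly_deg_coord i j : poly_deg 1 (fun x => x i j)
| poly_deg_add d f g :
    poly_deg d f -> poly_deg d g -> poly_deg d (fun x => f x + g x)
| poly_deg_mul d e f g :
    poly_deg d f -> poly_deg e g -> poly_deg (d + e) (fun x => f x * g x)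
| poly_deg_le d e f : (d <= e)%N -> poly_deg d f -> poly_deg e f.

Definition poly_fun f := exists d, poly_deg d f.

Lemma poly_deg_ext d f g : f =1 g -> poly_deg d f -> poly_deg d g.
Proof. by move=> /funext ->. Qed.

Lemma poly_fun_ext f g : f =1 g -> poly_fun f -> poly_fun g.
Proof. by move=> /funext ->. Qed.

Lemma poly_fun_cst c : poly_fun (fun=> c).
Proof. by exists 0%N; apply: poly_deg_cst. Qed.

Lemma poly_fun_coord i j : poly_fun (fun x => x i j).
Proof. by exists 1%N; apply: poly_deg_coord. Qed.

Lemma poly_fun_add f g :
  poly_fun f -> poly_fun g -> poly_fun (fun x => f x + g x).
Proof.
move=> [d hd] [e he]; exists (maxn d e); apply: poly_deg_add.
  by apply: poly_deg_le hd; rewrite leq_maxl.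
by apply: poly_deg_le he; rewrite leq_maxr.
Qed.

Lemma poly_fun_mul f g :
  poly_fun f -> poly_fun g -> poly_fun (fun x => f x * g x).
Proof. by move=> [d hd] [e he]; exists (d + e)%N; apply: poly_deg_mul. Qed.

Lemma poly_fun_opp f : poly_fun f -> poly_fun (fun x => - f x).
Proof.
move=> hf; apply: poly_fun_ext (poly_fun_mul (poly_fun_cst (-1)) hf) => x.
by rewrite mulN1r.
Qed.

Lemma poly_fun_sub f g :
  poly_fun f -> poly_fun g -> poly_fun (fun x => f x - g x).
Proof. by move=> hf hg; apply/poly_fun_add/poly_fun_opp. Qed.

Lemma poly_deg_sum (I : Type) (r : seq I) (P : pred I) d G :
  (forall i, poly_deg d (G i)) ->
  poly_deg d (fun x => \sum_(i <- r | P i) G i x).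
Proof.
move=> hG; elim: r => [|i r IH].
  by apply: poly_deg_ext (poly_deg_cst d 0) => x; rewrite big_nil.
case Pi: (P i).
  apply: poly_deg_ext (poly_deg_add (hG i) IH) => x.
  by rewrite big_cons Pi.
by apply: poly_deg_ext IH => x; rewrite big_cons Pi.
Qed.

Lemma poly_fun_sum (I : Type) (r : seq I) (P : pred I) G :
  (forall i, poly_fun (G i)) -> poly_fun (fun x => \sum_(i <- r | P i) G i x).
Proof.
move=> hG; elim: r => [|i r IH].
  by apply: poly_fun_ext (poly_fun_cst 0) => x; rewrite big_nil.
case Pi: (P i).
  by apply: poly_fun_ext (poly_fun_add (hG i) IH) => x; rewrite big_cons Pi.
by apply: poly_fun_ext IH => x; rewrite big_cons Pi.
Qed.

Lemma poly_fun_prod (I : Type) (r : seq I) (P : pred I) G :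
  (forall i, poly_fun (G i)) -> poly_fun (fun x => \prod_(i <- r | P i) G i x).
Proof.
move=> hG; elim: r => [|i r IH].
  by apply: poly_fun_ext (poly_fun_cst 1) => x; rewrite big_nil.
case Pi: (P i).
  by apply: poly_fun_ext (poly_fun_mul (hG i) IH) => x; rewrite big_cons Pi.
by apply: poly_fun_ext IH => x; rewrite big_cons Pi.
Qed.

Lemma poly_deg_exp d f e :
  poly_deg d f -> poly_deg (d * e) (fun x => f x ^+ e).
Proof.
move=> hf; elim: e => [|e IH].
  by apply: poly_deg_ext (poly_deg_cst _ 1) => x; rewrite expr0.
rewrite mulnS; apply: poly_deg_ext (poly_deg_mul hf IH) => x.
by rewrite exprS.
Qed.

Lemma poly_fun_exp f e : poly_fun f -> poly_fun (fun x => f x ^+ e).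
Proof. by move=> [d hf]; exists (d * e)%N; apply: poly_deg_exp. Qed.

Lemma poly_fun_poly_at p : poly_fun (@poly_at F m n p).
Proof.
rewrite /poly_at.
apply: (@poly_fun_ext (fun x => \sum_(mm <- mpoly.msupp p)
  mpoly.mcoeff mm p * \prod_(i < m * n) (mxvec x 0 i) ^+ (mpoly.fun_of_multinom mm i))).
  by move=> x; rewrite mpoly.mevalE.
apply: poly_fun_sum => mm; apply: poly_fun_mul; first exact: poly_fun_cst.
apply: poly_fun_prod => i; apply: poly_fun_exp.
case/mxvec_indexP: i => i j.
by apply: poly_fun_ext (poly_fun_coord i j) => x; rewrite mxvecE.
Qed.

Lemma poly_funP f : poly_fun f <-> exists p, f = @poly_at F m n p.
Proof.
split=> [[d]|[p ->]]; last exact: poly_fun_poly_at.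
elim=> [{}d c|i j|{}d {}f g _ [p ->] _ [q ->]|{}d e {}f g _ [p ->] _ [q ->]|//].
- by exists (mpoly.mpolyC _ c); apply/funext => x; rewrite /poly_at mpoly.mevalC.
- exists (mpoly.mpolyX _ (mpoly.mnm1 (mxvec_index i j))); apply/funext => x.
  by rewrite /poly_at mpoly.mevalXU mxvecE.
- by exists (p + q); apply/funext => x; rewrite /poly_at mpoly.mevalD.
- by exists (p * q); apply/funext => x; rewrite /poly_at mpoly.mevalM.
Qed.

(** Along a line only one variable remains, so that zeros can be counted; by the size bound, [d.+1]
    zeros force the restriction to vanish. *)
Lemma poly_deg_line d f (u v : 'M[F]_(m, n)) : poly_deg d f ->
  exists2 p : {poly F}, (size p <= d.+1)%N & forall s, f (u + s *: v) = p.[s].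
Proof.
elim=> [{}d c|i j|{}d {}f g _ [p sp hp] _ [q sq hq]
  |{}d e {}f g _ [p sp hp] _ [q sq hq]|{}d e {}f le_de _ [p sp hp]].
- exists c%:P; last by move=> s; rewrite hornerC.
  by rewrite size_polyC; case: (c != 0).
- exists ((u i j)%:P + v i j *: 'X); last first.
    by move=> s; rewrite !mxE !hornerE mulrC.
  rewrite (leq_trans (size_polyD _ _)) // geq_max size_polyC.
  rewrite (leq_trans (size_scale_leq _ _)) ?size_polyX // andbT.
  by case: (_ != 0).
- exists (p + q); last by move=> s; rewrite hornerD hp hq.
  by rewrite (leq_trans (size_polyD _ _)) // geq_max sp.
- exists (p * q); last by move=> s; rewrite hornerM hp hq.
  by rewrite (leq_trans (size_polyMleq _ _)) //; lia.
- by exists p => //; apply: leq_trans sp _.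
Qed.

Lemma poly_fun_line f (u v : 'M[F]_(m, n)) : poly_fun f ->
  exists p : {poly F}, forall s, f (u + s *: v) = p.[s].
Proof. by move=> [d /(poly_deg_line u v) [p _ hp]]; exists p. Qed.

Lemma poly_fun_det k (A : 'M[F]_(m, n) -> 'M[F]_k) :
  (forall i j, poly_fun (fun x => A x i j)) -> poly_fun (fun x => \det (A x)).
Proof.
move=> hA; apply: poly_fun_sum => s.
by apply: poly_fun_mul; [apply: poly_fun_cst | apply: poly_fun_prod].
Qed.

Lemma poly_fun_mulmx k l r (A : 'M[F]_(m, n) -> 'M[F]_(k, l))
    (B : 'M[F]_(m, n) -> 'M[F]_(l, r)) :
  (forall i j, poly_fun (fun x => A x i j)) ->
  (forall i j, poly_fun (fun x => B x i j)) ->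
  forall i j, poly_fun (fun x => (A x *m B x) i j).
Proof.
move=> hA hB i j.
apply: (@poly_fun_ext (fun x => \sum_l A x i l * B x l j)) => [x|].
  by rewrite mxE.
by apply: poly_fun_sum => a; apply: poly_fun_mul.
Qed.

End PolynomialFunctions.

Lemma poly_deg_comp (F : fieldType) m n p q d k (f : 'M[F]_(m, n) -> F)
    (phi : 'M[F]_(p, q) -> 'M[F]_(m, n)) :
  poly_deg d f -> (forall i j, poly_deg k (fun x => phi x i j)) ->
  poly_deg (k * d) (f \o phi).
Proof.
move=> hf hphi.
elim: hf => [e c|i j|e g h _ IHg _ IHh|e e' g h _ IHg _ IHh|e e' g le_ee' _ IH].
- exact: poly_deg_cst.
- by rewrite muln1; apply: hphi.
- exact: poly_deg_add.
- by rewrite mulnDr; apply: poly_deg_mul.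
- by apply: poly_deg_le IH; rewrite leq_mul2l le_ee' orbT.
Qed.

Lemma poly_deg_bound (F : fieldType) m n p q
    (phi : 'M[F]_(p, q) -> 'M[F]_(m, n)) :
  (forall i j, poly_fun (fun x => phi x i j)) ->
  exists k, forall i j, poly_deg k (fun x => phi x i j).
Proof.
move=> /(_ _ _)/cid hphi.
exists (\max_(i : 'I_m * 'I_n) projT1 (hphi i.1 i.2))%N => i j.
apply: poly_deg_le (projT2 (hphi i j)).
exact: (leq_bigmax (i, j) (F := fun i => projT1 (hphi i.1 i.2))).
Qed.

Lemma poly_fun_comp (F : fieldType) m n p q (f : 'M[F]_(m, n) -> F)
    (phi : 'M[F]_(p, q) -> 'M[F]_(m, n)) :
  poly_fun f -> (forall i j, poly_fun (fun x => phi x i j)) ->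
  poly_fun (f \o phi).
Proof.
move=> [d hf] /poly_deg_bound [k hk].
by exists (k * d)%N; apply: poly_deg_comp.
Qed.

(** * Zariski topology *)

Section ZariskiTopology.
Variables (F : fieldType) (m n : nat).
Implicit Types (A Y Z W : set 'M[F]_(m, n)) (f g : 'M[F]_(m, n) -> F).

Lemma zariski_closed_zeros f : poly_fun f -> zariski_closed (fun x => f x = 0).
Proof.
move=> /poly_funP [p ->]; exists (fun q => q = p); apply/seteqP; split=> x /=.
  by move=> hx q ->.
by apply.
Qed.

Lemma zariski_closureP A x :
  zariski_closure A x <->
  forall f, poly_fun f -> (forall y, A y -> f y = 0) -> f x = 0.
Proof.
split=> [hx f hf fA|hx W [[S ->] AW] p Sp].
  by apply: (hx (fun x => f x = 0)); split; [apply: zariski_closed_zeros|].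
by apply: hx => [|y /AW /(_ p Sp)//]; apply: poly_fun_poly_at.
Qed.

Lemma zariski_closed_closure A : zariski_closed (zariski_closure A).
Proof.
exists (fun p => forall y, A y -> poly_at p y = 0).
apply/seteqP; split=> x /=.
  by move=> /zariski_closureP hx p; apply: hx; apply: poly_fun_poly_at.
move=> hx; apply/zariski_closureP => f /poly_funP [p ->]; exact: hx.
Qed.

Lemma subset_zariski_closure A x : A x -> zariski_closure A x.
Proof. by move=> Ax; apply/zariski_closureP => f _; apply. Qed.

Lemma zariski_closure_mono A Y x : (forall y, A y -> Y y) ->
  zariski_closure A x -> zariski_closure Y x.
Proof.
move=> AY /zariski_closureP hx; apply/zariski_closureP => f hf fY.
by apply: hx => // y /AY /fY.
Qed.

Lemma zariski_closed_setI Z W :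
  zariski_closed Z -> zariski_closed W -> zariski_closed (setI Z W).
Proof.
move=> [S ->] [T ->]; exists (setU S T); apply/seteqP; split=> x /=.
  by move=> [hS hT] p [/hS|/hT].
by move=> hx; split=> p hp; apply: hx; [left|right].
Qed.

(* Irreducibility expressed with polynomial functions instead of closed sets. *)
Definition prime_locus Z :=
  (exists z, Z z) /\
  forall f g, poly_fun f -> poly_fun g -> (forall z, Z z -> f z * g z = 0) ->
  (forall z, Z z -> f z = 0) \/ (forall z, Z z -> g z = 0).

Lemma irreducible_prime Z : irreducible Z <-> prime_locus Z.
Proof.
split=> -[Z0 hZ]; split=> //.
  move=> f g hf hg fg.
  have cl h : poly_fun h -> closed_in Z (setI (fun x => h x = 0) Z).
    by move=> /zariski_closed_zeros ?; exists (fun x => h x = 0).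
  have [|e|e] := hZ _ _ (cl f hf) (cl g hg).
  - apply/seteqP; split=> x /=; last by case=> -[].
    move=> Zx; have /eqP := fg x Zx; rewrite mulf_eq0 => /orP[] /eqP h0.
      by left.
    by right.
  - by left=> z; rewrite e => -[].
  - by right=> z; rewrite e => -[].
move=> A B [V [S ->] ->] [W [T ->] ->] e.
have sub U : (forall z, Z z -> U z) -> Z = setI U Z.
  by move=> h; apply/seteqP; split=> z //=; [move=> Zz; split=> //; apply: h|case].
apply: contrapT => /not_orP [nA nB].
have [z Zz [p [Sp pz]]] : exists2 z, Z z & exists p, S p /\ poly_at p z <> 0.
  apply: contrapT => h; apply: nA; apply: sub => z Zz; rewrite /= => p Sp.
  by apply: contrapT => pz; apply: h; exists z => //; exists p.
have [w Zw [q [Tq qw]]] : exists2 z, Z z & exists p, T p /\ poly_at p z <> 0.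
  apply: contrapT => h; apply: nB; apply: sub => w Zw; rewrite /= => q Tq.
  by apply: contrapT => qw; apply: h; exists w => //; exists q.
have [|h|h] := hZ (poly_at p) (poly_at q) (poly_fun_poly_at p) (poly_fun_poly_at q).
- move=> x; rewrite {1}e => -[] [hx _].
    by rewrite hx ?mul0r.
  by rewrite (hx q) ?mulr0.
- by apply: pz; apply: h.
- by apply: qw; apply: h.
Qed.

(** A polynomial function that vanishes on [A] vanishes on its closure, hence on every [Y] in
    between. *)
Lemma prime_locus_closure A Y :
  prime_locus A -> (forall x, A x -> Y x) ->
  (forall x, Y x -> zariski_closure A x) -> prime_locus Y.
Proof.
move=> [[a Aa] hA] AY YA; split; first by exists a; apply: AY.
have vanish h : poly_fun h -> (forall x, A x -> h x = 0) ->
    forall x, Y x -> h x = 0.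
  by move=> hh h0 x /YA /zariski_closureP; apply.
move=> f g hf hg fg.
have [z /AY/fg //|h|h] := hA f g hf hg.
  by left; apply: vanish.
by right; apply: vanish.
Qed.

End ZariskiTopology.

(** * Irreducibility of polynomial images *)

Section Images.
Variables (F : numFieldType) (m n p q : nat).

(** Natural numbers are pairwise distinct in [F]. With roots beyond every bound, choosing each new
    root above all previous ones would produce more roots than the size of [r] allows. *)
Lemma poly_finite_zeros (r : {poly F}) :
  r != 0 -> exists N : nat, forall i : nat, (N <= i)%N -> r.[i%:R] != 0.
Proof.
move=> r0; apply: contrapT => /forallNP hN.
have {}hN N : exists2 i : nat, (N <= i)%N & r.[i%:R] = 0.
  apply: contrapT => h; apply: (hN N) => i Ni; apply/negP => /eqP ri.
  by apply: h; exists i.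
suff /(_ (size r)) [s us [rs ss]] : forall k, exists2 s : seq F, uniq s
    & all (root r) s /\ size s = k.
  by have := max_poly_roots r0 rs us; rewrite ss ltnn.
suff h k : exists2 s : seq nat, uniq s &
    all (fun i : nat => root r i%:R) s /\ size s = k.
  move=> k; have [s us [rs ss]] := h k.
  exists [seq i%:R | i <- s]; last by rewrite all_map size_map.
  by rewrite map_inj_uniq // => i j /eqP; rewrite eqr_nat => /eqP.
elim: k => [|k [s us [rs ss]]]; first by exists [::].
have [i Ni ri] := hN (\max_(j <- s) j).+1%N.
exists (i :: s); rewrite /= ?us ?ss ?rs ?andbT; last by split=> //; apply/eqP.
by apply/negP => /(leq_bigmax_seq (F := id)) /(_ isT) /(leq_trans Ni); rewrite ltnn.
Qed.

Definition line_closed (K : set 'M[F]_(p, q)) :=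
  forall u v s, K u -> K v -> K (u + s *: (v - u)).

(** Zariski openness, expressed by a principal open neighbourhood of each point. *)
Definition open_locus (U : set 'M[F]_(p, q)) :=
  forall u, U u -> exists h,
    [/\ poly_fun h, h u != 0 & forall v, h v != 0 -> U v].

Lemma poly_fun_line_neq0 (f : 'M[F]_(p, q) -> F) u v x0 : poly_fun f ->
  f (u + x0 *: (v - u)) != 0 ->
  exists2 r : {poly F}, r != 0 & forall s, f (u + s *: (v - u)) = r.[s].
Proof.
move=> /(poly_fun_line u (v - u)) [r hr] f0; exists r => //.
by apply: contraNneq f0 => r0; rewrite hr r0 horner0.
Qed.

(** Suppose [f] is nonzero at [phi u] and [g] at [phi v]. On the line through [u] and [v], the
    pullbacks of [f] and [g] and the function defining a neighbourhood of [u] in [U] are three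
    nonzero polynomials in one variable; at a common non-root the product of [f] and [g] does not
    vanish. *)
Lemma prime_locus_image (K U : set 'M[F]_(p, q))
    (phi : 'M[F]_(p, q) -> 'M[F]_(m, n)) :
  line_closed K -> open_locus U -> (exists u, K u /\ U u) ->
  (forall i j, poly_fun (fun x => phi x i j)) ->
  prime_locus (fun x => exists u, [/\ K u, U u & x = phi u]).
Proof.
move=> hK hU [u0 [Ku0 Uu0]] hphi; split.
  by exists (phi u0), u0.
move=> f g hf hg fg; apply: contrapT => /not_orP [].
move=> /existsNP [x1 /not_implyP [[u [Ku Uu ->]] fu]].
move=> /existsNP [x2 /not_implyP [[v [Kv Uv ->]] gv]].
have [h [hh hu hUh]] := hU u Uu.
have lu : u + 0 *: (v - u) = u by rewrite scale0r addr0.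
have lv : u + 1 *: (v - u) = v by rewrite scale1r addrC subrK.
have [|r1 n1 e1] := poly_fun_line_neq0 (u := u) (v := v) (x0 := 0) (poly_fun_comp hf hphi).
  by rewrite lu; apply/eqP.
have [|r2 n2 e2] := poly_fun_line_neq0 (u := u) (v := v) (x0 := 1) (poly_fun_comp hg hphi).
  by rewrite lv; apply/eqP.
have [|r3 n3 e3] := poly_fun_line_neq0 (u := u) (v := v) (x0 := 0) hh.
  by rewrite lu.
have [|N hN] := @poly_finite_zeros (r1 * r2 * r3); first by rewrite !mulf_neq0.
have := hN N (leqnn _); rewrite !hornerM !mulf_eq0 -e1 -e2 -e3 !negb_or /=.
move=> /andP [/andP [f1 g1] h1].
have /eqP := fg _ (ex_intro _ _ (And3 (hK _ _ N%:R Ku Kv) (hUh _ h1) erefl)).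
by rewrite mulf_eq0 (negPf f1) (negPf g1).
Qed.

End Images.

(** * Upper bound for the length of chains *)

Section UpperBound.
Variables (F : fieldType) (m n : nat).

Definition lin_indep_on (Z : set 'M[F]_(m, n)) (J : finType)
    (g : J -> 'M[F]_(m, n) -> F) :=
  forall c : J -> F,
    (forall z, Z z -> \sum_j c j * g j z = 0) -> forall j, c j = 0.

Lemma closed_separation (Y Z Z' : set 'M[F]_(m, n)) :
  closed_in Y Z -> closed_in Y Z' -> proper Z Z' ->
  exists f, [/\ poly_fun f, forall z, Z z -> f z = 0
             & exists2 z, Z' z & f z != 0].
Proof.
move=> [W [S ->] ->] [W' _ ->] [_ /existsNP [z /not_implyP [[W'z Yz] nz]]].
have [p [Sp pz]] : exists p, S p /\ poly_at p z <> 0.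
  apply: contrapT => h; apply: nz; split=> // p Sp.
  by apply: contrapT => pz; apply: h; exists p.
exists (poly_at p); split; first exact: poly_fun_poly_at.
  by move=> x [/(_ p Sp)].
by exists z => //; apply/eqP.
Qed.

(* In a vanishing combination the lowest power of f can be cancelled, as Z' is
   irreducible; what remains restricts to Z as a combination of the g j. *)
Lemma lin_indep_extend (Z Z' : set 'M[F]_(m, n)) (J : finType) g f t :
  prime_locus Z' -> (forall z, Z z -> Z' z) ->
  poly_fun f -> (forall j, poly_fun (g j)) ->
  (forall z, Z z -> f z = 0) -> (exists2 z, Z' z & f z != 0) ->
  lin_indep_on Z g ->
  lin_indep_on Z' (fun (u : J * 'I_t) x => g u.1 x * f x ^+ u.2).
Proof.
move=> [_ pZ'] ZZ' hf hg fZ [z0 Zz0 fz0] gZ c hc [j i] /=.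
suff h k : forall i : 'I_t, (i < k)%N -> forall j, c (j, i) = 0.
  exact: (h i.+1).
elim: k => [//|k IH] {}i; rewrite ltnS leq_eqVlt => /orP [/eqP ik {}j|]; last exact: IH.
pose G x := \sum_(u : J * 'I_t)
  (if (i <= u.2)%N then c (u.1, u.2) * (g u.1 x * f x ^+ (u.2 - i)) else 0).
have hG : poly_fun G.
  apply: poly_fun_sum => u; case: (i <= u.2)%N; last exact: poly_fun_cst.
  apply: poly_fun_mul; first exact: poly_fun_cst.
  by apply: poly_fun_mul => //; apply: poly_fun_exp.
have [z Zz|h|h] := pZ' (fun x => f x ^+ i) G (poly_fun_exp i hf) hG.
- rewrite mulr_sumr -[RHS](hc z Zz); apply: eq_bigr => -[j' i'] _ /=.
  case: leqP => [le_ii'|lt_i'i]; last by rewrite IH ?mulr0 ?mul0r // -ik.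
  rewrite -[in RHS](subnKC le_ii') exprD; ring.
- by have /eqP := h _ Zz0; rewrite expf_eq0 (negPf fz0) andbF.
apply: (gZ (fun j => c (j, i))) => z Zz.
rewrite -[RHS](h z (ZZ' z Zz)) /G.
rewrite -(pair_bigA _ (fun j (i' : 'I_t) => if (i <= i')%N
   then c (j, i') * (g j z * f z ^+ (i' - i)) else 0)) /=.
apply: eq_bigr => j' _; rewrite (bigD1 i) //= leqnn subnn expr0 mulr1.
rewrite big1 ?addr0 // => i' ii'; case: leqP => // le_ii'.
rewrite fZ // expr0n subn_eq0 leqNgt ltn_neqAle le_ii' andbT.
by rewrite eq_sym (inj_eq val_inj) ii' !mulr0.
Qed.

(** Each step of the chain has a function that vanishes on the smaller set but not on the larger
    one. Multiplying by its first [t] powers makes the family [t] times larger and raises the degree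
    by a multiple of [t]. The constant [K] does not depend on [t]. *)
Lemma chain_growth Y (Z : nat -> set 'M[F]_(m, n)) e :
  (forall i, (i <= e)%N -> closed_in Y (Z i) /\ irreducible (Z i)) ->
  (forall i, (i < e)%N -> proper (Z i) (Z i.+1)) ->
  exists K, forall t, exists (J : finType) (g : J -> 'M[F]_(m, n) -> F),
    [/\ #|J| = (t ^ e)%N, forall j, poly_deg (K * t) (g j)
      & lin_indep_on (Z e) g].
Proof.
elim: e => [|e IH] hZ hp.
  have [_ [[z Zz] _]] := hZ 0%N (leqnn _).
  exists 0%N => t; exists unit, (fun _ _ => 1); split.
  - by rewrite card_unit.
  - by move=> _; apply: poly_deg_cst.
  - move=> c /(_ z Zz); rewrite (bigD1 tt) //= big1 => [|[] //].
    by rewrite addr0 mulr1 => c0 [].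
have [||K hK] := IH.
- by move=> i ie; apply: hZ; apply: leqW.
- by move=> i ie; apply: hp; apply: leqW.
have [ce _] := hZ e (leqnSn _).
have [ce' /irreducible_prime ie'] := hZ e.+1 (leqnn _).
have pe := hp e (leqnn _).
have [f [[d hf] f0 f1]] := closed_separation ce ce' pe.
exists (K + d)%N => t; have [J [g [cJ dg lg]]] := hK t.
exists (J * 'I_t)%type, (fun (u : J * 'I_t) x => g u.1 x * f x ^+ u.2); split.
- by rewrite card_prod cJ card_ord expnSr.
- move=> [j i] /=; rewrite mulnDl; apply: poly_deg_mul => //.
  by apply: poly_deg_le (poly_deg_exp i hf); rewrite leq_mul2l ltnW ?orbT.
- apply: lin_indep_extend lg => //; first by case: pe.
    by exists d.
  by move=> j; exists (K * t)%N.
Qed.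

End UpperBound.

(** * Polynomial functions of bounded degree on a finite grid *)

Section Counting.
Variables (F : numFieldType) (m n p q : nat).

Definition supported_on (S : pred ('I_p * 'I_q)) (P : 'M[F]_(p, q)) :=
  forall i j, ~~ S (i, j) -> P i j = 0.

(** The coordinates are released from the grid one at a time: in each of them the function is a
    polynomial of degree at most [d] with [d.+1] roots. *)
Lemma grid_vanish S d (f : 'M[F]_(p, q) -> F) : poly_deg d f ->
  (forall P, supported_on S P ->
     (forall i j, exists k : 'I_d.+1, P i j = k%:R) -> f P = 0) ->
  forall P, supported_on S P -> f P = 0.
Proof.
move=> hf h0 P SP.
(* [L] lists the positions that are already free; those outside [L] still carry grid values. *)
suff h (L : seq ('I_p * 'I_q)) : forall P, supported_on S P ->
    (forall i j, (i, j) \notin L -> exists k : 'I_d.+1, P i j = k%:R) -> f P = 0.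
  by apply: (h (enum {: 'I_p * 'I_q}) P SP) => i j; rewrite mem_enum.
elim: L {P SP} => [|[i j] L IH] P SP hP; first by apply: h0 => // i j; apply: hP.
case Sij: (S (i, j)); last first.
  apply: IH => // a b ab; have [[-> ->]|ne] := eqVneq (a, b) (i, j).
    by exists ord0; rewrite SP ?Sij.
  by apply: hP; rewrite inE negb_or ne.
have [r sr hr] := poly_deg_line P (delta_mx i j) hf.
(* At this parameter the entry at [(i, j)] becomes [k], a grid value, and the induction hypothesis
   applies. *)
have root_r (k : 'I_d.+1) : r.[k%:R - P i j] = 0.
  rewrite -hr; apply: IH => [a b nS|a b ab].
    rewrite !mxE (SP a b nS) add0r; case: eqP => [ai|]; last by rewrite mulr0.
    by case: eqP => [bj|]; rewrite ?mulr0 //; move: nS; rewrite ai bj Sij.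
  rewrite !mxE; have [[-> ->]|ne] := eqVneq (a, b) (i, j).
    by exists k; rewrite !eqxx mulr1 addrC subrK.
  rewrite -pair_eqE /= in ne; rewrite (negPf ne) mulr0 addr0.
  by apply: hP; rewrite inE negb_or ab andbT.
have r0 : r = 0.
  apply/eqP/negPn/negP => r0.
  have := @max_poly_roots _ r [seq k%:R - P i j | k : 'I_d.+1 <- enum 'I_d.+1] r0.
  rewrite size_map size_enum_ord => h.
  suff: (d.+1 < size r)%N by rewrite ltnNge sr.
  apply: h; first by apply/allP => _ /mapP [k _ ->]; apply/eqP.
  rewrite map_inj_uniq ?enum_uniq // => k l /addIr /eqP.
  by rewrite eqr_nat => /eqP /val_inj.
by rewrite -[P]addr0 -(scale0r (delta_mx i j)) hr r0 horner0.
Qed.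

(** The matrix of the values of the functions at the grid points has more rows than columns, so its
    rows are dependent. The resulting combination vanishes on the grid, hence on all matrices
    supported on [S]. *)
Lemma dependent_family S d (J : finType) (g : J -> 'M[F]_(p, q) -> F) :
  (forall j, poly_deg d (g j)) -> (d.+1 ^ #|S| < #|J|)%N ->
  exists2 c : J -> F, (exists j, c j != 0) &
    forall P, supported_on S P -> \sum_j c j * g j P = 0.
Proof.
move=> hg cJ; pose I := {s : 'I_p * 'I_q | S s}.
pose G : finType := {ffun I -> 'I_d.+1}.
have cG : #|G| = (d.+1 ^ #|S|)%N by rewrite card_ffun card_ord card_sig.
pose pt (u : G) : 'M[F]_(p, q) := \matrix_(i, j)
  (if insub (i, j) is Some s then (u s)%:R else 0).
pose A := \matrix_(a < #|J|, b < #|G|) g (enum_val a) (pt (enum_val b)).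
have : kermx A != 0.
  rewrite kermx_eq0 /row_free; apply/negP => /eqP rA.
  by have := rank_leq_col A; rewrite rA cG leqNgt cJ.
move=> /rowV0Pn [v /sub_kermxP vA v0].
pose c j := v 0 (enum_rank j).
have sumE P : \sum_j c j * g j P = \sum_(a < #|J|) v 0 a * g (enum_val a) P.
  rewrite (reindex _ (onW_bij _ (@enum_val_bij J))) /=.
  by apply: eq_bigr => a _; rewrite /c enum_valK.
exists c.
  have [a va] : exists a, v 0 a != 0.
    apply: contrapT => /forallNP h; case/eqP: v0; apply/rowP => a.
    by rewrite mxE; apply/eqP/negPn/negP/h.
  by exists (enum_val a); rewrite /c enum_valK.
apply: (@grid_vanish _ d).
  apply: poly_deg_sum => j; rewrite -[d]add0n.
  by apply: poly_deg_mul => //; apply: poly_deg_cst.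
move=> P SP /(_ _ _)/cid gP.
pose u : G := [ffun s : I => projT1 (gP (val s).1 (val s).2)].
have -> : P = pt u.
  apply/matrixP => i j; rewrite mxE; case: insubP => [s Ss es|nS]; last exact: SP.
  by rewrite ffunE -(projT2 (gP _ _)) es.
rewrite sumE; move/rowP/(_ (enum_rank u)): vA; rewrite !mxE => h.
rewrite -[RHS]h; apply: eq_bigr => a _; by rewrite mxE enum_rankK.
Qed.

(* A chain of length e provides t ^ e independent functions of degree O(t), but
   pulled back along phi they are determined by their values on a grid of
   O(t ^ #|S|) points. *)
Lemma chain_length_le (Y : set 'M[F]_(m, n)) (S : pred ('I_p * 'I_q))
    (phi : 'M[F]_(p, q) -> 'M[F]_(m, n)) e :
  (forall i j, poly_fun (fun x => phi x i j)) ->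
  (forall y, Y y ->
     zariski_closure (fun x => exists2 P, supported_on S P & x = phi P) y) ->
  irreducible_chain Y e -> (e <= #|S|)%N.
Proof.
move=> /poly_deg_bound [k hk] YS [Z [hZ hp]].
have [K hK] := chain_growth hZ hp.
rewrite leqNgt; apply/negP => Se.
(* Chosen so that [(k * (K * t)).+1 ^ #|S|] is at most [((k * K).+1 * t) ^ #|S|], which is smaller
   than [t ^ #|S|.+1] and hence than or equal to no more than [t ^ e]. *)
pose t := ((k * K).+1 ^ #|S|).+1.
have [J [g [cJ dg lg]]] := hK t.
have [||c [j cj] hc] := @dependent_family S (k * (K * t)) J (fun j => g j \o phi).
- by move=> j; apply: poly_deg_comp.
- rewrite cJ -(subnKC Se) addSn expnS expnD.
  apply: (@leq_ltn_trans (((k * K).+1 * t) ^ #|S|)).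
    by case: (#|S|) => // s; rewrite leq_exp2r // /t; lia.
  rewrite expnMn mulnCA mulnC ltn_pmul2l ?expn_gt0 //.
  rewrite (@leq_trans t) // leq_pmulr // expn_gt0 //.
suff : c j = 0 by apply/eqP.
apply: lg => z Zz; have [[W _ We] _] := hZ e (leqnn e).
have /YS /zariski_closureP : Y z by move: Zz; rewrite We => -[].
move=> /(_ (fun y => \sum_i c i * g i y)); apply.
  apply: poly_fun_sum => i; apply: poly_fun_mul; first exact: poly_fun_cst.
  by exists (K * t)%N.
by move=> y [P SP ->]; apply: hc.
Qed.

End Counting.

(** * Construction of chains *)

Section LowerBound.
Variables (F : numFieldType) (m n p q : nat).
Variables (phi : 'M[F]_(p, q) -> 'M[F]_(m, n)) (Y : set 'M[F]_(m, n)).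
Variables (S : pred ('I_p * 'I_q)) (lev : 'I_p * 'I_q -> nat).
Variables (psi : 'I_p * 'I_q -> 'I_m * 'I_n).
Variables (Q0 : 'M[F]_(p, q)) (h : 'M[F]_(p, q) -> F).
Hypothesis poly_phi : forall i j, poly_fun (fun x => phi x i j).
Hypothesis poly_h : poly_fun h.
Hypothesis hQ0 : h Q0 != 0.
Hypothesis phiY : forall Q, h Q != 0 -> Y (phi Q).
(* A parameter can be read off an entry of phi Q as soon as the parameters of
   higher level have their base values. *)
Hypothesis psiK : forall s (Q : 'M[F]_(p, q)), S s ->
  (forall s', S s' ==> (lev s < lev s')%N -> Q s'.1 s'.2 = Q0 s'.1 s'.2) ->
  phi Q (psi s).1 (psi s).2 = Q s.1 s.2.

(** The parameters are freed in order of increasing level. The [i]-th term of the chain is the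
    closure in [Y] of the image of the matrices in which only the first [i] parameters are free. It
    is strictly smaller than the next term: the entry at [psi s] is constant on it, but varies once
    [s] is free. *)
Lemma chain_of_levels : irreducible_chain Y #|S|.
Proof.
pose ss := sort (relpre lev leq) (enum S).
have sS : size ss = #|S| by rewrite size_sort -cardE.
have uS : uniq ss by rewrite sort_uniq enum_uniq.
have mS s : (s \in ss) = S s by rewrite mem_sort mem_enum.
have srt : sorted (relpre lev leq) ss by apply: sort_sorted => x y; apply: leq_total.
pose K i (Q : 'M[F]_(p, q)) :=
  forall s, s \notin take i ss -> Q s.1 s.2 = Q0 s.1 s.2.
pose im i x := exists u, [/\ K i u, h u != 0 & x = phi u].
have imY i x : im i x -> Y x by case=> u [_ hu ->]; apply: phiY.
exists (fun i => setI (zariski_closure (im i)) Y); split=> i ie.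
  split; first by exists (zariski_closure (im i)) => //; apply: zariski_closed_closure.
  apply/irreducible_prime; apply: (@prime_locus_closure _ _ _ (im i)).
  - apply: prime_locus_image => //.
    + by move=> u v c hu hv s hs; rewrite !mxE hu // hv // subrr mulr0 addr0.
    + by move=> u hu; exists h.
    + by exists Q0.
  - by move=> x hx; split; [apply: subset_zariski_closure|apply: imY hx].
  - by move=> x [].
have iss : (i < size ss)%N by rewrite sS.
have sub s : s \in take i ss -> s \in take i.+1 ss.
  by rewrite (take_nth s) // mem_rcons inE orbC => ->.
split.
  move=> x [cx Yx]; split=> //; apply: zariski_closure_mono cx => _ [u [Ku hu ->]].
  by exists u; split=> // s hs; apply: Ku; apply: contra (hs); apply: sub.
have [s0 _] : exists s, s \in ss.
  by exists (tnth (in_tuple ss) (Ordinal iss)); apply: mem_tnth.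
pose s := nth s0 ss i.
have ms : s \in ss by apply: mem_nth.
have Ss : S s by rewrite -mS.
have snt : s \notin take i ss.
  apply/negP => /(nthP s0) [j]; rewrite size_take iss => ji.
  by rewrite nth_take // => /eqP; rewrite nth_uniq ?(ltn_trans ji) // ltn_eqF.
have recov Q : K i.+1 Q -> phi Q (psi s).1 (psi s).2 = Q s.1 s.2.
  (* The implication also covers positions outside [S]; they do not occur in [ss] and keep their
     base values. A position of [S] of higher level comes after [s] in [ss], so it is still
     fixed. *)
  move=> KQ; apply: psiK => // s' /implyP Ss'.
  apply: KQ; apply/negP => h'.
  have {Ss'} := Ss' _; rewrite -mS (mem_take h') => /(_ isT).
  move: h' => /(nthP s0) [j]; rewrite size_takel // ltnS => ji.
  rewrite nth_take // => <-; rewrite ltnNge; case/negP.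
  have tr : transitive (relpre lev leq) by move=> x y z; apply: leq_trans.
  have rf : reflexive (relpre lev leq) by move=> x /=.
  apply: (sorted_leq_nth tr rf s0 srt) => //; rewrite inE //.
  exact: leq_ltn_trans iss.
move=> sup.
(* Moving only the parameter [s] away from [Q0] by a large positive integer keeps [h] nonzero and
   changes the entry at [psi s]. *)
have [r rh] := poly_fun_line Q0 (delta_mx s.1 s.2) poly_h.
have [|N hN] := @poly_finite_zeros _ r.
  by apply: contraNneq hQ0 => r0; rewrite -[Q0]addr0 -(scale0r (delta_mx s.1 s.2)) rh r0 horner0.
pose Q := Q0 + N.+1%:R *: delta_mx s.1 s.2.
have KQ : K i.+1 Q.
  move=> s' hs'; rewrite !mxE.
  have ne : s' != s.
    by apply: contraNneq hs' => ->; rewrite (take_nth s0) // mem_rcons inE eqxx.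
  case: eqP => [e1|]; last by rewrite mulr0 addr0.
  case: eqP => [e2|]; last by rewrite mulr0 addr0.
  by move: ne; rewrite -pair_eqE /= e1 e2 !eqxx.
have hQ : h Q != 0 by rewrite rh; apply: hN.
have im1 : im i.+1 (phi Q) by exists Q.
have [|/zariski_closureP cl _] := sup (phi Q).
  by split; [apply: subset_zariski_closure | apply: imY im1].
have := cl (fun x => x (psi s).1 (psi s).2 - Q0 s.1 s.2).
rewrite recov // !mxE !eqxx mulr1 addrAC subrr add0r.
case/(_ _ _)/eqP/negP.
- by apply: poly_fun_sub; [apply: poly_fun_coord|apply: poly_fun_cst].
- move=> _ [u [Ku hu ->]]; rewrite recov ?Ku ?subrr // => s' hs'.
  by apply: Ku; apply: contra (hs'); apply: sub.
- by rewrite pnatr_eq0.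
Qed.

End LowerBound.

(** * Cells of square-zero matrices *)

Section Matrices.
Variables (F : fieldType) (n : nat).
Implicit Types (x y u v g : 'M[F]_n) (J : pred 'I_n).
Local Notation pid := (@pid_mx F n n).

Definition upper u := forall i j : 'I_n, (j < i)%N -> u i j = 0.

Lemma upper1 : upper 1%:M.
Proof. by move=> i j ji; rewrite mxE -val_eqE gtn_eqF. Qed.

Lemma strictly_upper_upper x : strictly_upper x -> upper x.
Proof. by move=> hx i j /ltnW; apply: hx. Qed.

Lemma upperD u v : upper u -> upper v -> upper (u + v).
Proof. by move=> hu hv i j ij; rewrite mxE hu // hv // addr0. Qed.

Lemma upperN u : upper u -> upper (- u).
Proof. by move=> hu i j ij; rewrite mxE hu // oppr0. Qed.

Lemma upperM u v : upper u -> upper v -> upper (u *m v).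
Proof.
move=> hu hv i j ij; rewrite mxE big1 // => l _.
case: (ltnP l i) => li; first by rewrite hu // mul0r.
by rewrite hv ?mulr0 // (leq_trans ij).
Qed.

Lemma strictly_upperMl u x : upper u -> strictly_upper x -> strictly_upper (u *m x).
Proof.
move=> hu hx i j ij; rewrite mxE big1 // => l _.
case: (ltnP l i) => li; first by rewrite hu // mul0r.
by rewrite hx ?mulr0 // (leq_trans ij).
Qed.

Lemma strictly_upperMr u x : upper u -> strictly_upper x -> strictly_upper (x *m u).
Proof.
move=> hu hx i j ij; rewrite mxE big1 // => l _.
case: (leqP l i) => li; first by rewrite hx // mul0r.
by rewrite hu ?mulr0 // (leq_ltn_trans ij).
Qed.

Lemma mul_mx_pid x m i j : (x *m pid m) i j = if (j < m)%N then x i j else 0.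
Proof.
rewrite mxE (bigD1 j) //= mxE eqxx big1 /= => [|l lj].
  by case: ifP; rewrite ?mulr1 ?mulr0 addr0.
by rewrite mxE val_eqE (negPf lj) mulr0.
Qed.

Lemma mul_pid_mx_l x m i j : (pid m *m x) i j = if (i < m)%N then x i j else 0.
Proof.
rewrite mxE (bigD1 i) //= mxE eqxx big1 /= => [|l li].
  by case: ifP; rewrite ?mul1r ?mul0r addr0.
by rewrite mxE val_eqE eq_sym (negPf li) mul0r.
Qed.

Lemma upper_pid u m : upper u -> u *m pid m = pid m *m u *m pid m.
Proof.
move=> hu; apply/matrixP => i j; rewrite !mul_mx_pid mul_pid_mx_l.
case: (ltnP j m) => // jm; case: (ltnP i m) => // mi.
by rewrite hu // (leq_trans jm).
Qed.

(** An invertible upper triangular factor on the right mixes the first [m] columns only among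
    themselves, and so does its inverse. *)
Lemma rank_upper_pid x u v m : upper u -> upper v -> u *m v = 1%:M ->
  \rank (x *m u *m pid m) = \rank (x *m pid m).
Proof.
move=> hu hv uv; apply/eqP; rewrite eqn_leq; apply/andP; split.
  by rewrite -mulmxA (upper_pid m hu) !mulmxA -!(mulmxA (x *m _)) mxrankM_maxl.
have -> : x *m pid m = x *m u *m pid m *m (v *m pid m).
  rewrite -!mulmxA; congr (_ *m _); rewrite (mulmxA (pid m)) -upper_pid //.
  by rewrite mulmxA uv mul1mx.
exact: mxrankM_maxl.
Qed.

Lemma rank_unit_l x g g' k (p : 'M[F]_(n, k)) : g' *m g = 1%:M ->
  \rank (g *m x *m p) = \rank (x *m p).
Proof.
move=> gg; apply/eqP; rewrite eqn_leq; apply/andP; split.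
  by rewrite -mulmxA mxrankM_maxr.
have -> : x *m p = g' *m (g *m x *m p) by rewrite !mulmxA gg mul1mx.
exact: mxrankM_maxr.
Qed.

Definition proj_mx_on J : 'M[F]_n := \matrix_(i, j) ((i == j) && J i)%:R.
Local Notation "'d_ J" := (proj_mx_on J) (at level 8, J at level 2).

Lemma mul_mx_proj x J i j : (x *m 'd_J) i j = if J j then x i j else 0.
Proof.
rewrite mxE (bigD1 j) //= mxE eqxx big1 /= => [|l lj].
  by case: ifP; rewrite ?mulr1 ?mulr0 addr0.
by rewrite mxE (negPf lj) mulr0.
Qed.

Lemma mul_proj_mx x J i j : ('d_J *m x) i j = if J i then x i j else 0.
Proof.
rewrite mxE (bigD1 i) //= mxE eqxx big1 /= => [|l li].
  by case: ifP; rewrite ?mul1r ?mul0r addr0.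
by rewrite mxE eq_sym (negPf li) mul0r.
Qed.

Lemma rank_proj_le J : (\rank 'd_J <= #|J|)%N.
Proof.
have -> : 'd_J = \sum_(i | J i) delta_mx i i.
  apply/matrixP => a b; rewrite mxE summxE.
  case Ja: (J a); last first.
    rewrite andbF big1 // => i Ji; rewrite mxE.
    by case: eqP => // ai; rewrite ai Ji in Ja.
  rewrite (bigD1 a) //= mxE eqxx /= eq_sym andbT big1 ?addr0 // => i /andP [_ ia].
  by rewrite mxE eq_sym (negPf ia).
rewrite -sum1_card; elim/big_ind2: _ => [|A a B b hA hB|i _].
- by rewrite mxrank0.
- by rewrite (leq_trans (mxrank_add _ _)) // leq_add.
- by rewrite mxrank_delta.
Qed.

(** The columns indexed by [J] are independent, since they are the only nonzero ones and the rank
    equals their number; hence so are those among the first [m]. *)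
Lemma rank_proj_pid x J m : x *m 'd_J = x -> \rank x = #|J| ->
  \rank (x *m pid m) = #|[pred i | J i && (i < m)%N]|.
Proof.
move=> xJ rx; pose J1 := [pred i | J i && (i < m)%N].
pose J2 := [pred i | J i && (m <= i)%N].
have cJ : #|J| = (#|J1| + #|J2|)%N.
  rewrite -cardUI [X in (_ + X)%N]eq_card0 ?addn0; last first.
    by move=> i; rewrite !inE; case: (J i) => //=; rewrite ltnNge andNb.
  apply: eq_card => i; rewrite !inE -topredE /=.
  by case: (J i) => //=; rewrite ltnNge orNb.
have e1 : x *m pid m = x *m 'd_J1.
  rewrite -{1}xJ; apply/matrixP => i j; rewrite mul_mx_pid !mul_mx_proj /=.
  by case: (J j); case: (j < m)%N.
have e2 : x = x *m 'd_J1 + x *m 'd_J2.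
  rewrite -{1}xJ; apply/matrixP => i j; rewrite [in RHS]mxE !mul_mx_proj /=.
  by case: (J j) => /=; rewrite ?addr0 // ltnNge; case: (m <= j)%N; rewrite ?add0r ?addr0.
rewrite e1; apply/eqP; rewrite eqn_leq; apply/andP; split.
  by rewrite (leq_trans (mxrankM_maxr _ _)) ?rank_proj_le.
rewrite -(leq_add2r #|J2|) -cJ -rx {1}e2 (leq_trans (mxrank_add _ _)) // leq_add2l.
by rewrite (leq_trans (mxrankM_maxr _ _)) ?rank_proj_le.
Qed.

Lemma rank_flag x J g g' u v m : x *m 'd_J = x -> \rank x = #|J| ->
  g' *m g = 1%:M -> upper u -> upper v -> u *m v = 1%:M ->
  \rank (g *m x *m u *m pid m) = #|[pred i | J i && (i < m)%N]|.
Proof.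
move=> xJ rx gg hu hv uv.
by rewrite (rank_upper_pid _ _ hu hv uv) (rank_unit_l _ _ gg) (rank_proj_pid _ xJ).
Qed.

(** Multiplication by [pid m] keeps the first [m] columns, so [J] indexes the columns outside the
    span of the preceding ones. For strictly upper matrices these ranks agree with those of the
    corner blocks. *)
Definition pivot_cell J : set 'M[F]_n := fun x =>
  [/\ strictly_upper x, x *m x = 0, \rank x = #|J| &
   forall m, (m <= n)%N ->
     \rank (x *m pid m) = #|[pred i | J i && (i < m)%N]|].

(* N takes its (i, j) entry from position (j, i) of P, so that N and C use
   disjoint sets of positions. *)
Definition cell_N J (P : 'M[F]_n) : 'M[F]_n :=
  \matrix_(i, j) if [&& J i, ~~ J j & (i < j)%N] then P j i else 0.

Definition cell_C J (P : 'M[F]_n) : 'M[F]_n :=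
  \matrix_(i, j) if [&& ~~ J i, J j & (i < j)%N] then P i j else 0.

Definition cell_mx J P : 'M[F]_n :=
  (1%:M - cell_N J P) *m cell_C J P *m (1%:M + cell_N J P).

Lemma cell_NN J P : cell_N J P *m cell_N J P = 0.
Proof.
apply/matrixP => i j; rewrite !mxE big1 // => l _; rewrite !mxE.
by case: (J l); rewrite ?andbF /= ?mul0r ?mulr0.
Qed.

Lemma cell_CC J P : cell_C J P *m cell_C J P = 0.
Proof.
apply/matrixP => i j; rewrite !mxE big1 // => l _; rewrite !mxE.
by case: (J l); rewrite ?andbF /= ?mul0r ?mulr0.
Qed.

Lemma cell_N_inv J P : (1%:M + cell_N J P) *m (1%:M - cell_N J P) = 1%:M.
Proof.
by rewrite mulmxDl mul1mx mulmxBr mulmx1 cell_NN subr0 subrK.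
Qed.

Lemma cell_N_inv' J P : (1%:M - cell_N J P) *m (1%:M + cell_N J P) = 1%:M.
Proof. by apply: mulmx1C; apply: cell_N_inv. Qed.

Lemma cell_C_strict J P : strictly_upper (cell_C J P).
Proof. by move=> i j ij; rewrite mxE ltnNge ij !andbF. Qed.

Lemma cell_N_strict J P : strictly_upper (cell_N J P).
Proof. by move=> i j ij; rewrite mxE ltnNge ij !andbF. Qed.

Lemma cell_C_proj J P : cell_C J P *m 'd_J = cell_C J P.
Proof.
by apply/matrixP => i j; rewrite mul_mx_proj mxE; case: (J j); rewrite ?andbF.
Qed.

Lemma upper_addN J P : upper (1%:M + cell_N J P).
Proof. by apply/upperD/strictly_upper_upper/cell_N_strict; apply: upper1. Qed.

Lemma upper_subN J P : upper (1%:M - cell_N J P).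
Proof.
apply: upperD; first exact: upper1.
exact/upperN/strictly_upper_upper/cell_N_strict.
Qed.

Lemma conj_sq0 x g g' : g' *m g = 1%:M -> x *m x = 0 ->
  (g *m x *m g') *m (g *m x *m g') = 0.
Proof.
move=> gg xx; rewrite !mulmxA -(mulmxA _ g' g) gg mulmx1 -(mulmxA _ x x) xx.
by rewrite mulmx0 mul0mx.
Qed.

Lemma rank_conj x g g' : g' *m g = 1%:M -> \rank (g *m x *m g') = \rank x.
Proof.
move=> gg; rewrite (rank_unit_l _ _ gg); apply/eqP; rewrite eqn_leq mxrankM_maxl /=.
have -> : \rank x = \rank (x *m g' *m g) by rewrite -mulmxA gg mulmx1.
exact: mxrankM_maxl.
Qed.

Lemma pivot_cell_mx J P : \rank (cell_C J P) = #|J| -> pivot_cell J (cell_mx J P).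
Proof.
move=> rC; split.
- by apply/(strictly_upperMr (@upper_addN _ _))/strictly_upperMl/cell_C_strict; apply: upper_subN.
- by apply: conj_sq0 (cell_CC J P); apply: cell_N_inv.
- by rewrite rank_conj //; apply: cell_N_inv.
- move=> m _; apply: rank_flag (cell_C_proj J P) rC (cell_N_inv J P) _ _ (cell_N_inv J P).
    exact: upper_addN.
  exact: upper_subN.
Qed.

(** Column spaces of [x] are handled as row spaces of its transpose. By induction on [m]: a new
    column in [J] is itself one of the generators, and a new column outside [J] does not raise the
    rank. *)
Lemma pivot_cell_span J x : pivot_cell J x -> forall m, (m <= n)%N ->
  (pid m *m x^T <= 'd_J *m (pid m *m x^T))%MS.
Proof.
move=> [_ _ _ hr]; elim=> [|m IH] mn; first by rewrite pid_mx_0 mul0mx sub0mx.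
have {}IH := IH (ltnW mn); pose o := Ordinal mn.
have row_pid m' i : row i (pid m' *m x^T) = if (i < m')%N then row i x^T else 0.
  by apply/rowP => j; rewrite mxE mul_pid_mx_l; case: ifP; rewrite !mxE.
have mono : (pid m *m x^T <= pid m.+1 *m x^T)%MS.
  apply/row_subP => i; rewrite row_pid; case: ifP => [im|]; last by rewrite sub0mx.
  by have := row_sub i (pid m.+1 *m x^T); rewrite row_pid ltnW.
have monoJ : ('d_J *m (pid m *m x^T) <= 'd_J *m (pid m.+1 *m x^T))%MS.
  have -> : 'd_J *m (pid m *m x^T) = pid m *m ('d_J *m (pid m.+1 *m x^T)).
    apply/matrixP => i j; rewrite mul_proj_mx !mul_pid_mx_l mul_proj_mx mul_pid_mx_l.
    by case: (J i); case: ltnP => // im; rewrite ltnW.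
  exact: submxMl.
case Jo: (J o).
  apply/row_subP => i; rewrite row_pid; case: ifP => [im|]; last by rewrite sub0mx.
  move: (im); rewrite ltnS leq_eqVlt => /orP [/eqP io|{}im].
    have -> : i = o by apply/val_inj.
    have -> : row o x^T = row o ('d_J *m (pid m.+1 *m x^T)).
      by apply/rowP => j; rewrite [RHS]mxE mul_proj_mx Jo mul_pid_mx_l /= ltnSn mxE.
    exact: row_sub.
  apply: submx_trans monoJ; apply: submx_trans IH.
  by have := row_sub i (pid m *m x^T); rewrite row_pid im.
apply: submx_trans monoJ; apply: submx_trans IH.
have rk m' : (m' <= n)%N -> \rank (pid m' *m x^T) = #|[pred i | J i && (i < m')%N]|.
  by move=> /hr <-; rewrite -mxrank_tr trmx_mul trmxK tr_pid_mx.
rewrite -(mxrank_leqif_sup mono) !rk ?(ltnW mn) //; apply/eqP/eq_card => i.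
rewrite !inE; case Ji: (J i) => //=; rewrite [RHS]ltnS [RHS]leq_eqVlt; case: eqP => //= im.
by move: Jo; rewrite (_ : o = i) ?Ji //; apply/val_inj; rewrite /= im.
Qed.

(** Each column outside [J] is a combination of earlier columns in [J], and these coefficients form
    [N]. Conjugation by [1%:M + N] clears the columns outside [J]; the square-zero condition and the
    rank then clear the rows in [J]. *)
Lemma pivot_cell_param J x : pivot_cell J x ->
  exists P, \rank (cell_C J P) = #|J| /\ x = cell_mx J P.
Proof.
move=> hx; have span := pivot_cell_span hx; case: hx => [sx xx rx _].
have /choice [w wP] (j : 'I_n) : exists w : 'rV[F]_n, ~~ J j ->
    forall i, x i j = \sum_(s | J s && (s < j)%N) w 0 s * x i s.
  have := span j.+1 (ltn_ord j); move=> /submxP [D eD].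
  exists (row j D) => nJ i.
  move/matrixP/(_ j i): eD; rewrite mul_pid_mx_l ltnSn mxE => ->.
  rewrite mxE [RHS]big_mkcond; apply: eq_bigr => s _.
  rewrite mul_proj_mx mul_pid_mx_l ltnS !mxE leq_eqVlt.
  case Js: (J s) => /=; last by rewrite mulr0.
  have [sj|_] /= := eqVneq (val s) (val j); last by case: ifP; rewrite ?mulr0.
  by move: nJ; rewrite -(val_inj sj) Js.
pose P0 : 'M[F]_n := \matrix_(i, j) w i 0 j.
pose N := cell_N J P0; pose y := (1%:M + N) *m x *m (1%:M - N).
have xN : x *m (1%:M - N) = x *m 'd_J.
  apply/matrixP => i j; rewrite mulmxBr mulmx1 mul_mx_proj [LHS]mxE [X in _ + X]mxE [X in _ - X]mxE.
  case Jj: (J j).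
    by rewrite big1 ?subr0 // => s _; rewrite !mxE Jj andbF mulr0.
  rewrite (wP j) ?Jj // [X in X - _]big_mkcond -sumrB big1 // => s _.
  by rewrite !mxE Jj /=; case: ifP => _; rewrite ?mulr0 ?subr0 // mulrC subrr.
have yJ : y *m 'd_J = y.
  have -> : y = (1%:M + N) *m x *m 'd_J by rewrite /y -!mulmxA xN.
  by apply/matrixP => i j; rewrite !mul_mx_proj; case: (J j).
have ry : \rank y = #|J| by rewrite rank_conj // cell_N_inv'.
have yy : y *m y = 0 by apply: conj_sq0 xx; apply: cell_N_inv'.
have sy : strictly_upper y.
  by apply/(strictly_upperMr (@upper_subN _ _))/strictly_upperMl/sx; apply: upper_addN.
(* The row space of [y] lies in that of ['d_J] and has the same dimension, so ['d_J] is a left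
   multiple of [y], and [y *m y = 0] applies. *)
have Jy : 'd_J *m y = 0.
  have /submxP [L ->] : ('d_J <= y)%MS.
    have s : (y <= 'd_J)%MS by rewrite -yJ submxMl.
    rewrite -(mxrank_leqif_sup s) eqn_leq (mxrankS s) ry; exact: rank_proj_le.
  by rewrite -mulmxA yy mulmx0.
pose P : 'M[F]_n := \matrix_(i, j) if (j < i)%N then w i 0 j else y i j.
have NP : cell_N J P = N.
  apply/matrixP => i j; rewrite !mxE; case: ifP => // /and3P [_ _ ij].
  by rewrite ij.
have CP : cell_C J P = y.
  apply/matrixP => i j; rewrite [LHS]mxE; case: ifP => [/and3P [_ _ ij]|].
    by rewrite [LHS]mxE ltnNge (ltnW ij).
  move/negbT; rewrite !negb_and negbK -leqNgt => /or3P [Ji|nJj|ji].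
  - by have /matrixP/(_ i j) := Jy; rewrite mul_proj_mx Ji [RHS]mxE => ->.
  - by rewrite -yJ mul_mx_proj (negPf nJj).
  - by rewrite sy.
exists P; rewrite /cell_mx CP NP; split=> //.
rewrite /y !mulmxA cell_N_inv' mul1mx -mulmxA cell_N_inv' mulmx1 //.
Qed.

End Matrices.

(** * Lower bounds on the rank as nonvanishing of determinants *)

Section RankLoci.
Variables (F : fieldType) (m n : nat).

(** A generalized minor: with [L] and [R] fixed, the determinant of [L *m M' *m R] is polynomial in
    [M'], is nonzero at [M], and where it is nonzero the rank of [M'] is at least that of [M]. *)
Lemma rank_witness (M : 'M[F]_(m, n)) :
  exists (L : 'M_(\rank M, m)) (R : 'M_(n, \rank M)), L *m M *m R = 1%:M.
Proof.
exists (pinvmx (col_base M)), (pinvmx (row_base M)).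
rewrite -[X in _ *m X *m _](mulmx_base M) mulmxA mulVpmx ?col_base_full // mul1mx.
by rewrite mulmxVp ?row_base_free.
Qed.

Lemma rank_det_neq0 k (L : 'M_(k, m)) (M : 'M[F]_(m, n)) (R : 'M_(n, k)) :
  \det (L *m M *m R) != 0 -> (k <= \rank M)%N.
Proof.
rewrite -unitfE -[_ \is a _]/(_ \in unitmx) => /mxrank_unit <-.
by rewrite (leq_trans (mxrankM_maxl _ _)) ?mxrankM_maxr.
Qed.

Lemma poly_fun_rank_det p q k (L : 'M_(k, m)) (R : 'M_(n, k))
    (M : 'M[F]_(p, q) -> 'M[F]_(m, n)) :
  (forall i j, poly_fun (fun x => M x i j)) ->
  poly_fun (fun x => \det (L *m M x *m R)).
Proof.
move=> hM; apply: poly_fun_det; apply: poly_fun_mulmx; last first.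
  by move=> i j; apply: poly_fun_cst.
by apply: poly_fun_mulmx => // i j; apply: poly_fun_cst.
Qed.

End RankLoci.

(** An algebraic limit at [t = 0]: a polynomial in [t] with all positive integers as roots is
    zero. *)
Lemma zariski_closure_line (F : numFieldType) m n (A : set 'M[F]_(m, n)) x v :
  (forall t, t != 0 -> A (x + t *: v)) -> zariski_closure A x.
Proof.
move=> hA; apply/zariski_closureP => f hf fA.
have [r hr] := poly_fun_line x v hf.
have [r0|r0] := eqVneq r 0.
  rewrite r0 in hr; by rewrite -[x]addr0 -(scale0r v) hr horner0.
have [N hN] := poly_finite_zeros r0.
have := hN N.+1 (leqnSn _); rewrite -hr fA ?eqxx //.
by apply: hA; rewrite pnatr_eq0.
Qed.

(** * Irreducibility and dimension bound for cells and their closures *)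

Section Cells.
Variables (F : numFieldType) (n : nat).
Implicit Types J K : pred 'I_n.

Lemma poly_fun_if p q (c : bool) (f g : 'M[F]_(p, q) -> F) :
  poly_fun f -> poly_fun g -> poly_fun (fun x => if c then f x else g x).
Proof. by case: c. Qed.

Lemma poly_fun_addmx p q k l (f g : 'M[F]_(p, q) -> 'M[F]_(k, l)) :
  (forall i j, poly_fun (fun x => f x i j)) ->
  (forall i j, poly_fun (fun x => g x i j)) ->
  forall i j, poly_fun (fun x => (f x + g x) i j).
Proof.
move=> hf hg i j; apply: poly_fun_ext (poly_fun_add (hf i j) (hg i j)) => x.
by rewrite mxE.
Qed.

Lemma poly_fun_oppmx p q k l (f : 'M[F]_(p, q) -> 'M[F]_(k, l)) :
  (forall i j, poly_fun (fun x => f x i j)) ->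
  forall i j, poly_fun (fun x => (- f x) i j).
Proof.
move=> hf i j; apply: poly_fun_ext (poly_fun_opp (hf i j)) => x.
by rewrite mxE.
Qed.

Lemma poly_fun_1mx p q k i j : poly_fun (fun _ : 'M[F]_(p, q) => (1%:M : 'M[F]_k) i j).
Proof. exact: poly_fun_cst. Qed.

Lemma poly_fun_cell_C J i j : poly_fun (fun P => cell_C J P i j : F).
Proof.
apply: (poly_fun_ext (f := fun P => if [&& ~~ J i, J j & (i < j)%N] then P i j else 0)).
  by move=> P; rewrite mxE.
by apply: poly_fun_if; [apply: poly_fun_coord|apply: poly_fun_cst].
Qed.

Lemma poly_fun_cell_N J i j : poly_fun (fun P => cell_N J P i j : F).
Proof.
apply: (poly_fun_ext (f := fun P => if [&& J i, ~~ J j & (i < j)%N] then P j i else 0)).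
  by move=> P; rewrite mxE.
by apply: poly_fun_if; [apply: poly_fun_coord|apply: poly_fun_cst].
Qed.

Lemma poly_fun_cell_mx J i j : poly_fun (fun P => cell_mx J P i j : F).
Proof.
apply: poly_fun_mulmx; [apply: poly_fun_mulmx|].
- apply: poly_fun_addmx; first exact: poly_fun_1mx.
  exact/poly_fun_oppmx/poly_fun_cell_N.
- exact: poly_fun_cell_C.
- by apply: poly_fun_addmx; [apply: poly_fun_1mx|apply: poly_fun_cell_N].
Qed.

Lemma rank_cell_C_le J (P : 'M[F]_n) : (\rank (cell_C J P) <= #|J|)%N.
Proof.
by rewrite -cell_C_proj (leq_trans (mxrankM_maxr _ _)) ?rank_proj_le.
Qed.

(** The cell is the image under [cell_mx] of the parameters for which [cell_C] has rank [#|J|]. This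
    condition is open because [#|J|] is the largest possible rank. *)
Lemma prime_locus_pivot_cell J : (exists x : 'M[F]_n, pivot_cell J x) ->
  prime_locus (pivot_cell J : set 'M[F]_n).
Proof.
move=> [x0 /pivot_cell_param [P0 [rP0 _]]].
have -> : (pivot_cell J : set 'M[F]_n) =
    (fun x => exists u, [/\ True, \rank (cell_C J u) = #|J| & x = cell_mx J u]).
  apply/seteqP; split=> x; first by move=> /pivot_cell_param [P [rP ->]]; exists P.
  by move=> [P [_ rP ->]]; apply: pivot_cell_mx.
apply: (prime_locus_image (K := fun _ => True)
  (U := fun u => \rank (cell_C J u) = #|J|)) => //.
- move=> u ru; have [L [R LR]] := rank_witness (cell_C J u).
  exists (fun v => \det (L *m cell_C J v *m R)); split.
  + exact/poly_fun_rank_det/poly_fun_cell_C.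
  + by rewrite LR det1 oner_eq0.
  + move=> v /rank_det_neq0; rewrite ru => rv.
    by apply/eqP; rewrite eqn_leq rank_cell_C_le.
- by exists P0.
- exact: poly_fun_cell_mx.
Qed.

(** [cell_N] reads the positions below the diagonal and [cell_C] those above it; no diagonal
    position qualifies. *)
Definition cell_support J : pred ('I_n * 'I_n) := fun s => ~~ J s.1 && J s.2.

Lemma card_cell_support J : #|cell_support J| = ((n - #|J|) * #|J|)%N.
Proof.
have -> : (n - #|J| = #|[predC J]|)%N.
  have := cardC J; rewrite card_ord; move: #|J| #|[predC J]| => u v.
  lia.
by rewrite -cardX; apply: eq_card => -[i j]; rewrite !inE.
Qed.

Lemma cell_chain_le J (Y : set 'M[F]_n) e :
  (forall y, Y y -> zariski_closure (pivot_cell J) y) ->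
  irreducible_chain Y e -> (e <= #|cell_support J|)%N.
Proof.
move=> hY; apply: chain_length_le (poly_fun_cell_mx J) _ => y /hY.
apply: zariski_closure_mono => x /pivot_cell_param [P [_ ->]].
exists (\matrix_(i, j) if cell_support J (i, j) then P i j else 0).
  by move=> i j nS; rewrite mxE (negPf nS).
have eN : cell_N J P = cell_N J (\matrix_(i, j) if cell_support J (i, j) then P i j else 0).
  by apply/matrixP => i j; rewrite !mxE /cell_support /=; case: (J i); case: (J j).
have eC : cell_C J P = cell_C J (\matrix_(i, j) if cell_support J (i, j) then P i j else 0).
  by apply/matrixP => i j; rewrite !mxE /cell_support /=; case: (J i); case: (J j).
by rewrite /cell_mx -eN -eC.
Qed.

Definition cell_variety J : set 'M[F]_n :=
  setI (zariski_closure (pivot_cell J)) (setI (nilp_orbit #|J|) (@strictly_upper F n)).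

Lemma pivot_cell_variety J (x : 'M[F]_n) : pivot_cell J x -> cell_variety J x.
Proof. by move=> hx; split; [apply: subset_zariski_closure|case: hx]. Qed.

Lemma prime_locus_variety J : (exists x : 'M[F]_n, pivot_cell J x) ->
  prime_locus (cell_variety J).
Proof.
move=> /prime_locus_pivot_cell pJ; apply: prime_locus_closure pJ _ _.
  exact: pivot_cell_variety.
by move=> x [].
Qed.

(** Semicontinuity of the rank of the first [m] columns: a generalized minor that is nonzero at [x]
    vanishes on the whole cell of [K]. *)
Lemma pivot_cell_not_in_closure J K (x : 'M[F]_n) m : (m <= n)%N ->
  (#|[pred i | K i && (i < m)%N]| < #|[pred i | J i && (i < m)%N]|)%N ->
  pivot_cell J x -> ~ zariski_closure (pivot_cell K) x.
Proof.
move=> mn ltc [_ _ _ /(_ m mn) rx] /zariski_closureP clx.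
have [L [R LR]] := rank_witness (x *m (pid_mx m : 'M[F]_n)).
have hdet : poly_fun (fun y : 'M[F]_n => \det (L *m (y *m (pid_mx m : 'M[F]_n)) *m R)).
  apply: (poly_fun_rank_det L R); apply: poly_fun_mulmx => i j.
    exact: poly_fun_coord.
  exact: poly_fun_cst.
suff /(clx _ hdet)/eqP : forall y, pivot_cell K y ->
    \det (L *m (y *m (pid_mx m : 'M[F]_n)) *m R) = 0 by rewrite LR det1 oner_eq0.
move=> y [_ _ _ /(_ m mn) ry].
apply/eqP/negPn/negP => /rank_det_neq0.
by rewrite ry rx leqNgt ltc.
Qed.

Lemma codim_one_of_chain J K e :
  #|J| = #|K| -> (#|cell_support K| <= e.+1)%N ->
  (exists x : 'M[F]_n, pivot_cell K x /\ ~ zariski_closure (pivot_cell J) x) ->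
  irreducible_chain (setI (cell_variety K) (cell_variety J)) e ->
  has_codim (cell_variety K) (setI (cell_variety K) (cell_variety J)) 1.
Proof.
move=> cJK cS [x [Kx nJx]] ch.
have ext d : irreducible_chain (setI (cell_variety K) (cell_variety J)) d ->
    irreducible_chain (cell_variety K) d.+1.
  move=> [Z [hZ pZ]]; exists (fun i => if (i <= d)%N then Z i else cell_variety K).
  split=> i; last first.
    rewrite ltnS => id; rewrite id; case: ltnP => [|di]; first exact: pZ.
    have ed : i = d by apply/eqP; rewrite eqn_leq id.
    have [[W _ eW] _] := hZ i id; rewrite eW; split; first by move=> y [_ []].
    by move=> /(_ x (pivot_cell_variety Kx)) [_ [_ []]].
  rewrite leq_eqVlt => /orP [/eqP ->|].
    rewrite ltnn; split.
      exists (zariski_closure (pivot_cell K)); first exact: zariski_closed_closure.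
      by apply/seteqP; split=> y; [move=> hy; split=> //; case: hy|case].
    by apply/irreducible_prime/prime_locus_variety; exists x.
  rewrite ltnS => id; rewrite id; have [[W cW eW] irr] := hZ i id; split=> //.
  (* Sets closed in the intersection are closed in the larger variety: the two orbit conditions
     coincide, since [J] and [K] have the same cardinality. *)
  exists (setI W (zariski_closure (pivot_cell J))).
    by apply: zariski_closed_setI => //; apply: zariski_closed_closure.
  rewrite eW; apply/seteqP; split=> y.
    by move=> [Wy [Ky [clJ _]]].
  move=> [[Wy clJ] Ky]; split=> //; split=> //; split=> //.
  by rewrite cJK; case: Ky.
have bound d : irreducible_chain (cell_variety K) d -> (d <= e.+1)%N.
  by move=> /cell_chain_le dK; apply: leq_trans cS; apply: dK => y [].
exists e.+1, e; split; last by rewrite addn1.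
  by split; [apply: ext|].
by split=> // d /ext /bound.
Qed.

End Cells.

(** * A family of codimension one *)

Section Family.
Variables (F : numFieldType) (n : nat) (J : pred 'I_n) (a b : 'I_n).
Variables (mu nu : 'I_n -> 'I_n).
Hypothesis ltba : (b < a)%N.
Hypothesis Ja : J a.
Hypothesis nJb : ~~ J b.
Hypothesis mu_lt : forall s, J s -> ~~ J (mu s) && (mu s < s)%N.
Hypothesis mu_inj : {in J &, injective mu}.
Hypothesis mu_a : (mu a < b)%N.
Hypothesis mu_gt : forall s, J s -> (b < s < a)%N -> (b < mu s)%N.
Hypothesis nuP : forall m, ~~ J m -> (b < m < a)%N ->
  [/\ J (nu m), (b < nu m < a)%N & mu (nu m) = m].
Implicit Types (Q : 'M[F]_n) (s : 'I_n * 'I_n) (P : pred ('I_n * 'I_n)).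

(** Here [J] stands for the pivots of [Change T a b], and the swap gives back those of [T]. The map
    [mu] sends a pivot to its partner in a matching, and [nu] inverts it between [b] and [a]. *)
Definition pivot_swap : pred 'I_n := fun i => (i == b) || (J i && (i != a)).
Local Notation K := pivot_swap.

(* The parameters of the family: pos_N and pos_C are the positions of N and C.
   Instead of the entries of C in row b up to column a and in column a from row
   b on, we use coefficients in pos_A that add rows between b and a to row b, and
   coefficients in pos_D that add columns between b and a to column a. *)
Definition pos_N s := [&& ~~ J s.1, J s.2 & (s.2 < s.1)%N].
Definition pos_C s := [&& ~~ J s.1, J s.2, (s.1 < s.2)%N,
  ~~ ((s.1 == b) && (s.2 <= a)%N) & ~~ ((s.2 == a) && (b <= s.1)%N)].
Definition pos_A s := [&& s.1 == b, ~~ J s.2 & (b < s.2 < a)%N].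
Definition pos_D s := [&& s.2 == a, J s.1 & (b < s.1 < a)%N].
Definition fam_pos : pred ('I_n * 'I_n) :=
  fun s => [|| pos_N s, pos_C s, pos_A s | pos_D s].

Definition mask (P : pred ('I_n * 'I_n)) Q : 'M[F]_n :=
  \matrix_(i, j) if P (i, j) then Q i j else 0.

Lemma maskE P Q i j : mask P Q i j = if P (i, j) then Q i j else 0.
Proof. by rewrite mxE. Qed.

Lemma poly_fun_mask P i j : poly_fun (fun Q => mask P Q i j).
Proof.
apply: (poly_fun_ext (f := fun Q => if P (i, j) then Q i j else 0)).
  by move=> Q; rewrite mxE.
by apply: poly_fun_if; [apply: poly_fun_coord|apply: poly_fun_cst].
Qed.

Lemma mask_mul0 P P' Q Q' : (forall i j l : 'I_n, P (i, j) -> P' (j, l) -> False) ->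
  mask P Q *m mask P' Q' = 0.
Proof.
move=> h; apply/matrixP => i l; rewrite !mxE big1 // => j _; rewrite !mxE.
case: ifP => Pij; last by rewrite mul0r.
case: ifP => P'jl; last by rewrite mulr0.
by case: (h _ _ _ Pij P'jl).
Qed.

Local Notation G0 := (mask pos_C).
Local Notation A := (mask pos_A).
Local Notation D := (mask pos_D).
Local Notation N := (cell_N J).

Definition fam_g Q := (1%:M - N Q) *m (1%:M + A Q) *m (1%:M - D Q).
Definition fam_ginv Q := (1%:M + D Q) *m (1%:M - A Q) *m (1%:M + N Q).
Definition fam Q := fam_g Q *m G0 Q *m fam_ginv Q.

Lemma mulAA Q : A Q *m A Q = 0.
Proof.
apply: mask_mul0 => i j l /and3P [_ _ h] /and3P [/eqP /= e _ _]; move: h => /=.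
by rewrite e ltnn.
Qed.

Lemma mulDD Q : D Q *m D Q = 0.
Proof.
apply: mask_mul0 => i j l /and3P [/eqP /= e _ _] /and3P [_ _ /=].
by rewrite e ltnn andbF.
Qed.

Lemma mulDA Q : D Q *m A Q = 0.
Proof.
apply: mask_mul0 => i j l /and3P [/eqP /= -> _ _] /and3P [/eqP /= e _ _].
by move: Ja; rewrite e (negPf nJb).
Qed.

Lemma mulDG Q : D Q *m G0 Q = 0.
Proof.
apply: mask_mul0 => i j l /and3P [/eqP /= -> _ _] /andP [/=].
by rewrite Ja.
Qed.

Lemma mulGA Q : G0 Q *m A Q = 0.
Proof.
apply: mask_mul0 => i j l /and3P [_ /= Jj _] /and3P [/eqP /= e _ _].
by move: Jj; rewrite e (negPf nJb).
Qed.

Lemma mulGG Q : G0 Q *m G0 Q = 0.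
Proof.
apply: mask_mul0 => i j l /and3P [_ /= Jj _] /andP [/=].
by rewrite Jj.
Qed.

Lemma mulmx_1D_1B (x : 'M[F]_n) : x *m x = 0 -> (1%:M + x) *m (1%:M - x) = 1%:M.
Proof. by move=> xx; rewrite mulmxDl mul1mx mulmxBr mulmx1 xx subr0 subrK. Qed.

Lemma fam_inv Q : fam_g Q *m fam_ginv Q = 1%:M.
Proof.
rewrite /fam_g /fam_ginv !mulmxA -(mulmxA _ (1%:M - D Q)) (mulmx1C (mulmx_1D_1B (mulDD Q))).
by rewrite mulmx1 -(mulmxA _ (1%:M + A Q)) (mulmx_1D_1B (mulAA Q)) mulmx1 cell_N_inv'.
Qed.

Lemma upper_mask P Q : (forall i j, P (i, j) -> (i <= j)%N) -> upper (mask P Q).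
Proof.
move=> h i j ji; rewrite mxE; case: ifP => // /h.
by rewrite leqNgt ji.
Qed.

Lemma upper_mask_A Q : upper (A Q).
Proof. by apply: upper_mask => i j /and3P [/eqP /= -> _ /andP [/ltnW]]. Qed.

Lemma upper_mask_D Q : upper (D Q).
Proof. by apply: upper_mask => i j /and3P [/eqP /= -> _ /andP [_ /ltnW]]. Qed.

Lemma upper_fam_g Q : upper (fam_g Q).
Proof.
apply: upperM; first apply: upperM.
- exact: upper_subN.
- by apply: upperD; [apply: upper1|apply: upper_mask_A].
- by apply: upperD; [apply: upper1|apply/upperN/upper_mask_D].
Qed.

Lemma upper_fam_ginv Q : upper (fam_ginv Q).
Proof.
apply: upperM; first apply: upperM.
- by apply: upperD; [apply: upper1|apply: upper_mask_D].
- by apply: upperD; [apply: upper1|apply/upperN/upper_mask_A].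
- exact: upper_addN.
Qed.

Lemma fam_C0_strict Q : strictly_upper (G0 Q).
Proof.
move=> i j ji; rewrite mxE; case: ifP => // /and4P [_ _ /= ij _].
by rewrite leqNgt ij in ji.
Qed.

Lemma fam_C0_proj Q : G0 Q *m proj_mx_on F J = G0 Q.
Proof.
apply/matrixP => i j; rewrite mul_mx_proj mxE /pos_C /=.
by case: (J j); rewrite ?andbF.
Qed.

Lemma poly_fun_fam i j : poly_fun (fun Q => fam Q i j).
Proof.
have p1 (f : 'M[F]_n -> 'M[F]_n) : (forall i j, poly_fun (fun Q => f Q i j)) ->
    forall i j, poly_fun (fun Q => (1%:M + f Q) i j).
  by move=> hf; apply: poly_fun_addmx => // k l; apply: poly_fun_1mx.
apply: poly_fun_mulmx; first apply: poly_fun_mulmx.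
- apply: poly_fun_mulmx; first apply: poly_fun_mulmx; apply: p1.
  + exact/poly_fun_oppmx/poly_fun_cell_N.
  + exact: poly_fun_mask.
  + exact/poly_fun_oppmx/poly_fun_mask.
- exact: poly_fun_mask.
- apply: poly_fun_mulmx; first apply: poly_fun_mulmx; apply: p1.
  + exact: poly_fun_mask.
  + exact/poly_fun_oppmx/poly_fun_mask.
  + exact: poly_fun_cell_N.
Qed.

Lemma fam_pivot_cell Q : \rank (G0 Q) = #|J| -> pivot_cell J (fam Q).
Proof.
have gg' := mulmx1C (fam_inv Q); move=> rG; split.
- exact/(strictly_upperMr (@upper_fam_ginv Q))/(strictly_upperMl (@upper_fam_g Q))/fam_C0_strict.
- exact: conj_sq0 (mulGG Q).
- by rewrite rank_conj.
- move=> m _; apply: (rank_flag _ (fam_C0_proj Q) rG gg' _ _ gg').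
  exact: upper_fam_ginv.
  exact: upper_fam_g.
Qed.


Lemma card_pivot_swap : #|K| = #|J|.
Proof.
have nab : a != b by apply: contraTneq ltba => ->; rewrite ltnn.
have -> : #|J| = #|[predD1 J & a]|.+1 by rewrite (cardD1 a J) [a \in J]Ja.
have -> : #|K| = #|[predU1 b & [predD1 J & a]]|.
  by apply: eq_card => i; rewrite !inE /K -!topredE /= andbC.
by rewrite cardU1 !inE -!topredE /= (negPf nJb) andbF.
Qed.

Local Notation E := (delta_mx a b : 'M[F]_n).

Definition fam_dir Q := fam_g Q *m (E *m G0 Q - G0 Q *m E) *m fam_ginv Q.

Lemma delta_mulmxE (x : 'M[F]_n) i j : (E *m x) i j = if i == a then x b j else 0.
Proof.
rewrite mxE (bigD1 b) //= mxE eqxx andbT big1 => [|l lb].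
  by case: eqP; rewrite ?mul1r ?mul0r addr0.
by rewrite mxE (negPf lb) andbF mul0r.
Qed.

Lemma mulmx_deltaE (x : 'M[F]_n) i j : (x *m E) i j = if j == b then x i a else 0.
Proof.
rewrite mxE (bigD1 a) //= mxE eqxx /= big1 => [|l la].
  by case: eqP; rewrite ?mulr1 ?mulr0 addr0.
by rewrite mxE (negPf la) mulr0.
Qed.

Lemma fam_C0_row_b Q (j : 'I_n) : (j <= a)%N -> G0 Q b j = 0.
Proof. by move=> ja; rewrite mxE /pos_C /= eqxx ja !andbF. Qed.

Lemma fam_C0_col_a Q (i : 'I_n) : (b <= i)%N -> G0 Q i a = 0.
Proof. by move=> bi; rewrite mxE /pos_C /= eqxx bi !andbF. Qed.

Lemma delta_C_delta Q : E *m G0 Q *m E = 0.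
Proof.
apply/matrixP => i j; rewrite mulmx_deltaE delta_mulmxE fam_C0_row_b // mxE.
by rewrite !if_same.
Qed.

Lemma delta_delta : E *m E = 0.
Proof.
apply/matrixP => i j; rewrite delta_mulmxE 2!mxE eq_sym.
by have /ltn_eqF : (b < a)%N := ltba; rewrite val_eqE eq_sym => ->; case: ifP.
Qed.

(** Conjugation by [1%:M + t *: E] is affine in [t]: the quadratic term contains [E *m G0 Q *m E],
    which vanishes as the entry of [G0 Q] at [(b, a)] is zero. *)
Lemma fam_line Q t : fam Q + t *: fam_dir Q =
  (fam_g Q *m (1%:M + t *: E)) *m G0 Q *m ((1%:M - t *: E) *m fam_ginv Q).
Proof.
have e : (1%:M + t *: E) *m G0 Q *m (1%:M - t *: E) =
    G0 Q + t *: (E *m G0 Q - G0 Q *m E).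
  rewrite mulmxDl mul1mx -scalemxAl mulmxBr mulmx1 -scalemxAr mulmxDl -scalemxAl.
  by rewrite delta_C_delta scaler0 addr0 scalerBr addrA.
have -> : fam_g Q *m (1%:M + t *: E) *m G0 Q *m ((1%:M - t *: E) *m fam_ginv Q) =
    fam_g Q *m ((1%:M + t *: E) *m G0 Q *m (1%:M - t *: E)) *m fam_ginv Q.
  by rewrite !mulmxA.
by rewrite e mulmxDr mulmxDl -scalemxAr -scalemxAl.
Qed.

(** For nonzero [t], column [b] of [G0 Q *m (1%:M - t *: E)] is [- t] times column [a]. As [b]
    precedes [a], the pivot moves from [a] to [b]. *)
Lemma fam_line_pivot_cell Q t : \rank (G0 Q) = #|J| -> t != 0 ->
  pivot_cell K (fam Q + t *: fam_dir Q).
Proof.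
move=> rG t0; rewrite fam_line.
have tEE : (t *: E) *m (t *: E) = 0.
  by rewrite -scalemxAl -scalemxAr delta_delta !scaler0.
pose g := fam_g Q *m (1%:M + t *: E); pose g' := (1%:M - t *: E) *m fam_ginv Q.
have gg' : g' *m g = 1%:M.
  rewrite /g' /g mulmxA -(mulmxA _ (fam_ginv Q)) (mulmx1C (fam_inv Q)) mulmx1.
  exact/mulmx1C/mulmx_1D_1B.
rewrite -/g -/g'.
pose M := G0 Q *m (1%:M - t *: E).
(* Right multiplication by [1%:M + N2] restores column [a] from column [b]. *)
pose N2 : 'M[F]_n := (- t^-1) *: delta_mx b a.
have nab : a != b by apply: contraTneq ltba => ->; rewrite ltnn.
have Mij i j : M i j = G0 Q i j - t * (if j == b then G0 Q i a else 0).
  by rewrite /M mulmxBr mulmx1 -scalemxAr [LHS]mxE [X in _ + X]mxE [X in - X]mxE mulmx_deltaE.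
have G0b i : G0 Q i b = 0 by rewrite -fam_C0_proj mul_mx_proj (negPf nJb).
have eM : M = M *m proj_mx_on F K *m (1%:M + N2).
  apply/matrixP => i j; rewrite mulmxDr mulmx1 -scalemxAr [RHS]mxE [X in _ + X]mxE.
  have -> : (M *m proj_mx_on F K *m delta_mx b a) i j = if j == a then M i b else 0.
    rewrite mxE (bigD1 b) //= big1 => [|l lb]; last first.
      by rewrite [delta_mx _ _ _ _]mxE (negPf lb) mulr0.
    rewrite mul_mx_proj /K eqxx [delta_mx _ _ _ _]mxE eqxx /= addr0.
    by case: eqP; rewrite ?mulr1 ?mulr0.
  rewrite mul_mx_proj /K; have [->|ja] := eqVneq j a.
    rewrite (negPf nab) andbF add0r !Mij eqxx (negPf nab) mulr0 subr0 G0b sub0r.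
    by rewrite mulrN mulNr opprK mulrA mulVf // mul1r.
  rewrite mulr0 addr0 andbT; have [//|jb] /= := eqVneq j b.
  case Jj: (J j) => //=; rewrite Mij (negPf jb) mulr0 subr0 -fam_C0_proj mul_mx_proj Jj //.
have N2N2 : N2 *m N2 = 0.
  rewrite /N2 -scalemxAl -scalemxAr mul_delta_mx_0 ?scaler0 //.
have rM : \rank (M *m proj_mx_on F K) = #|K|.
  apply/eqP; rewrite eqn_leq (leq_trans (mxrankM_maxr _ _)) ?rank_proj_le //=.
  rewrite card_pivot_swap -rG (@leq_trans (\rank M)) //; last first.
    by rewrite {1}eM mxrankM_maxl.
  have -> : \rank (G0 Q) = \rank (M *m (1%:M + t *: E)).
    by rewrite /M -mulmxA (mulmx1C (mulmx_1D_1B tEE)) mulmx1.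
  exact: mxrankM_maxl.
have MK : M *m proj_mx_on F K *m proj_mx_on F K = M *m proj_mx_on F K.
  by apply/matrixP => i j; rewrite !mul_mx_proj; case: (K j).
have flag m : \rank (g *m G0 Q *m g' *m (pid_mx m : 'M_n)) = #|[pred i | K i && (i < m)%N]|.
  have -> : g *m G0 Q *m g' = g *m (M *m proj_mx_on F K) *m ((1%:M + N2) *m fam_ginv Q).
    by rewrite /g' !mulmxA -(mulmxA g) -/M {1}eM !mulmxA.
  apply: (rank_flag _ MK rM gg' _ _ (v := fam_g Q *m (1%:M - N2))).
  - apply: upperM (@upper_fam_ginv Q); apply: upperD; first exact: upper1.
    move=> i j ji; rewrite !mxE; case: eqP => [ib|]; last by rewrite mulr0.
    case: eqP => [ja|]; last by rewrite mulr0.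
    by move: ji; rewrite ib ja ltnNge (ltnW ltba).
  - apply: upperM (@upper_fam_g Q) _; apply: upperD; first exact: upper1.
    apply: upperN => i j ji; rewrite !mxE; case: eqP => [ib|]; last by rewrite mulr0.
    case: eqP => [ja|]; last by rewrite mulr0.
    by move: ji; rewrite ib ja ltnNge (ltnW ltba).
  - rewrite -mulmxA (mulmxA (fam_ginv Q)) (mulmx1C (fam_inv Q)) mul1mx.
    exact: mulmx_1D_1B.
split.
- rewrite -fam_line; move: (fam_C0_strict Q) => sG.
  have sd : strictly_upper (fam_dir Q).
    apply/(strictly_upperMr (@upper_fam_ginv Q))/(strictly_upperMl (@upper_fam_g Q)).
    move=> i j ji; rewrite [LHS]mxE [X in _ + X]mxE delta_mulmxE mulmx_deltaE.
    have -> : (if i == a then G0 Q b j else 0) = 0.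
      by case: eqP => // ia; rewrite fam_C0_row_b // -ia.
    have -> : (if j == b then G0 Q i a else 0) = 0.
      by case: eqP => // jb; rewrite fam_C0_col_a // -jb.
    by rewrite subr0.
  have sf : strictly_upper (fam Q).
    exact/(strictly_upperMr (@upper_fam_ginv Q))/(strictly_upperMl (@upper_fam_g Q)).
  by move=> i j ji; rewrite [LHS]mxE [X in _ + X]mxE sf // sd // mulr0 addr0.
- exact: conj_sq0 (mulGG Q).
- by rewrite rank_conj // card_pivot_swap.
- by move=> m _; apply: flag.
Qed.


Definition fam_C Q := (1%:M + A Q) *m G0 Q *m (1%:M + D Q).

(** Of the conjugations by [A] and [D] only one side acts, since [D *m G0], [G0 *m A] and [D *m A]
    vanish: [A] adds rows to row [b], and [D] adds columns to column [a]. *)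
Lemma fam_CE Q : fam Q = (1%:M - N Q) *m fam_C Q *m (1%:M + N Q).
Proof.
have e1 : (1%:M - D Q) *m G0 Q = G0 Q by rewrite mulmxBl mul1mx mulDG subr0.
have e2 : G0 Q *m (1%:M + D Q) *m (1%:M - A Q) = G0 Q *m (1%:M + D Q).
  rewrite mulmxBr mulmx1 mulmxDr mulmx1 mulmxDl mulGA -mulmxA mulDA mulmx0.
  by rewrite addr0 subr0.
rewrite /fam /fam_g /fam_ginv /fam_C -!mulmxA; congr (_ *m (_ *m _)).
by rewrite (mulmxA (1%:M - D Q)) e1 !mulmxA e2.
Qed.

Lemma fam_row Q i j : ~~ J i -> fam Q i j = fam_C Q i j + (fam_C Q *m N Q) i j.
Proof.
move=> nJi; rewrite fam_CE -mulmxA mulmxBl mul1mx [LHS]mxE [X in _ + X]mxE.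
have -> : (N Q *m (fam_C Q *m (1%:M + N Q))) i j = 0.
  by rewrite mxE big1 // => l _; rewrite mxE (negPf nJi) mul0r.
by rewrite subr0 mulmxDr mulmx1 mxE.
Qed.

Lemma fam_entry Q i j : ~~ J i -> J j -> fam Q i j = fam_C Q i j.
Proof.
move=> nJi Jj; rewrite fam_row //.
have -> : (fam_C Q *m N Q) i j = 0.
  by rewrite mxE big1 // => l _; rewrite [N Q l j]mxE Jj andbF mulr0.
by rewrite addr0.
Qed.

Lemma A_row0 Q (x : 'M[F]_n) i j : i != b -> (A Q *m x) i j = 0.
Proof.
move=> ib; rewrite mxE big1 // => l _; rewrite maskE /pos_A /= (negPf ib).
by rewrite mul0r.
Qed.

Lemma D_col0 Q (x : 'M[F]_n) i j : j != a -> (x *m D Q) i j = 0.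
Proof.
move=> ja; rewrite mxE big1 // => l _; rewrite [D Q l j]maskE /pos_D /= (negPf ja).
by rewrite mulr0.
Qed.

Lemma fam_C_row Q i j : i != b -> fam_C Q i j = G0 Q i j + (G0 Q *m D Q) i j.
Proof.
move=> ib; rewrite /fam_C -mulmxA mulmxDl mul1mx [LHS]mxE A_row0 // addr0.
by rewrite mulmxDr mulmx1 mxE.
Qed.

Lemma fam_C_col Q i j : j != a -> fam_C Q i j = G0 Q i j + (A Q *m G0 Q) i j.
Proof.
move=> ja; rewrite /fam_C mulmxDr mulmx1 [LHS]mxE D_col0 // addr0.
by rewrite mulmxDl mul1mx mxE.
Qed.

(** The strictly upper matrix of the matching [mu]. *)
Definition fam_base : 'M[F]_n := \matrix_(i, j) (J j && (i == mu j))%:R.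
Local Notation Q0 := fam_base.

(** The matching avoids the forced zeros: [a] is matched below [b], and a pivot strictly between [b]
    and [a] is matched above [b]. *)
Lemma pos_C_mu j : J j -> pos_C (mu j, j).
Proof.
move=> Jj; have /andP [nJ lt] := mu_lt Jj.
rewrite /pos_C /= nJ Jj lt /=; apply/andP; split; apply/negP => /andP [].
  move=> /eqP e; rewrite leq_eqVlt => /orP [/eqP /val_inj ja|ja].
    by move: mu_a; rewrite -ja e ltnn.
  have /(mu_gt Jj) : (b < j < a)%N by rewrite ja andbT -e.
  by rewrite e ltnn.
by move=> /eqP ->; rewrite leqNgt mu_a.
Qed.

Lemma base_C s : ~~ pos_C s -> Q0 s.1 s.2 = 0.
Proof.
case: s => i j nC; rewrite mxE; case Jj: (J j) => //=; case: eqP => // ij.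
by rewrite ij pos_C_mu in nC.
Qed.

Lemma fam_C0_base : G0 Q0 = Q0.
Proof.
apply/matrixP => i j; rewrite maskE; case: ifP => // /negbT nC.
by rewrite (base_C nC).
Qed.

Lemma rank_base : (#|J| <= \rank (G0 Q0))%N.
Proof.
rewrite fam_C0_base.
have e : Q0^T *m Q0 = proj_mx_on F J.
  apply/matrixP => i j; rewrite !mxE; case Ji: (J i); last first.
    by rewrite andbF big1 // => l _; rewrite !mxE Ji mul0r.
  rewrite andbT (bigD1 (mu i)) //= big1 ?addr0 => [|l li]; last first.
    by rewrite !mxE Ji (negPf li) mul0r.
  rewrite !mxE Ji eqxx mul1r; case Jj: (J j) => /=; last first.
    by case: eqP => // ij; rewrite -ij Ji in Jj.
  by congr (nat_of_bool _)%:R; apply/eqP/eqP => [/mu_inj ->|->].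
have c : (n <= \rank (proj_mx_on F J) + \rank (proj_mx_on F (predC J)))%N.
  have {1}-> : n = \rank (1%:M : 'M[F]_n) by rewrite mxrank1.
  rewrite (_ : 1%:M = proj_mx_on F J + proj_mx_on F (predC J)) ?mxrank_add //.
  apply/matrixP => i j; rewrite !mxE /=; case: eqP => _ /=; last by rewrite addr0.
  by case: (J i); rewrite ?addr0 ?add0r.
have := rank_proj_le F (predC J).
have cJ : (#|J| + #|predC J| = n)%N.
  exact: etrans (cardC J) (card_ord n).
have : (\rank (proj_mx_on F J) <= \rank Q0)%N by rewrite -e mxrankM_maxr.
move: cJ c; move: (\rank _) (\rank _) (\rank _) #|J| #|predC J|.
by move=> *; lia.
Qed.

(** Entries of [N] are read with [C], [A] and [D] at base values; entries of [C] in row [b] or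
    column [a] with [A] and [D] at base values; [A] and [D] with the rest of [C] at base values. The
    remaining entries of [C] can always be read. *)
Definition fam_lev s : nat :=
  if pos_N s then 0%N else
  if pos_C s then (if (s.1 == b) || (s.2 == a) then 1%N else 3%N) else 2%N.

(** Outside [pos_C], the entry chosen is the one where the parameter is multiplied by an entry 1 of
    the base matching. *)
Definition fam_psi s : 'I_n * 'I_n :=
  if pos_N s then (mu s.2, s.1) else if pos_C s then s else
  if pos_A s then (b, nu s.2) else (mu s.1, a).


Lemma pos_A_C s : pos_A s -> ~~ pos_C s.
Proof. by move=> /and3P [_ nJ _]; rewrite /pos_C (negPf nJ) andbF. Qed.

Lemma pos_D_C s : pos_D s -> ~~ pos_C s.
Proof. by move=> /and3P [_ Js _]; rewrite /pos_C Js. Qed.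

Lemma pos_N_C s : pos_N s -> ~~ pos_C s.
Proof. by move=> /and3P [_ _ lt]; rewrite /pos_C ltnNge (ltnW lt) !andbF. Qed.

Lemma pos_A_N s : pos_A s -> ~~ pos_N s.
Proof. by move=> /and3P [_ nJ _]; rewrite /pos_N (negPf nJ) andbF. Qed.

Lemma pos_D_N s : pos_D s -> ~~ pos_N s.
Proof. by move=> /and3P [_ Js _]; rewrite /pos_N Js. Qed.

Lemma mask_base0 P Q : (forall s, P s -> ~~ pos_C s) ->
  (forall s, P s -> Q s.1 s.2 = Q0 s.1 s.2) -> mask P Q = 0.
Proof.
move=> PC PQ; apply/matrixP => i j; rewrite maskE mxE; case: ifP => // Pij.
by rewrite (PQ _ Pij) (base_C (PC _ Pij)).
Qed.

Lemma fam_recover s Q : fam_pos s ->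
  (forall s', fam_pos s' ==> (fam_lev s < fam_lev s')%N ->
     Q s'.1 s'.2 = Q0 s'.1 s'.2) ->
  fam Q (fam_psi s).1 (fam_psi s).2 = Q s.1 s.2.
Proof.
move=> Ss hQ.
have fixA : (fam_lev s < 2)%N -> A Q = 0.
  move=> l2; apply: mask_base0 pos_A_C _ => s' As'; apply: hQ; apply/implyP => _.
  by rewrite {2}/fam_lev (negPf (pos_A_N As')) (negPf (pos_A_C As')).
have fixD : (fam_lev s < 2)%N -> D Q = 0.
  move=> l2; apply: mask_base0 pos_D_C _ => s' As'; apply: hQ; apply/implyP => _.
  by rewrite {2}/fam_lev (negPf (pos_D_N As')) (negPf (pos_D_C As')).
have fixC i j : (fam_lev s < 3)%N -> i != b -> j != a -> G0 Q i j = Q0 i j.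
  move=> l3 ib ja; rewrite maskE; case: ifP => [Cij|/negbT nC].
    apply: (hQ (i, j)); apply/implyP => _; rewrite {2}/fam_lev Cij /= (negPf ib) (negPf ja).
    by case: ifP => // /pos_N_C; rewrite Cij.
  by rewrite (base_C nC).
have gt0 (m : 'I_n) : (b < m)%N -> m != b by move=> h; rewrite -val_eqE gtn_eqF.
have lta (m : 'I_n) : (m < a)%N -> m != a by move=> h; rewrite -val_eqE ltn_eqF.
case Es: (pos_N s).
  have l0 : fam_lev s = 0%N by rewrite /fam_lev Es.
  have GQ : G0 Q = Q0.
    apply/matrixP => i j; rewrite maskE; case: ifP => [Cij|/negbT nC].
      apply: (hQ (i, j)); apply/implyP => _; rewrite l0 /fam_lev Cij.
      case: ifP => [/pos_N_C|_]; first by rewrite Cij.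
      by case: ifP.
    by rewrite (base_C nC).
  have CQ : fam_C Q = Q0.
    by rewrite /fam_C fixA ?fixD ?l0 // GQ !addr0 mul1mx mulmx1.
  case/and3P: (Es) => nJ J2 lt; have /andP [nJm _] := mu_lt J2.
  rewrite /fam_psi Es /= fam_row // CQ mxE (negPf nJ) add0r mxE (bigD1 s.2) //=.
  rewrite big1 => [|l ls].
    by rewrite !mxE J2 eqxx nJ lt mul1r addr0.
  rewrite mxE; case Jl: (J l) => /=; last by rewrite mul0r.
  case: eqP => [e|]; last by rewrite mul0r.
  by rewrite (mu_inj J2 Jl e) eqxx in ls.
case Cs: (pos_C s).
  rewrite /fam_psi Es Cs; case: s Ss hQ fixA fixD fixC Es Cs => i j /= Ss hQ fixA fixD fixC Es Cs.
  have GQ : G0 Q i j = Q i j by rewrite maskE Cs.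
  case/and5P: (Cs) => /= nJi Jj _ _ _; rewrite fam_entry //.
  have lev : fam_lev (i, j) = if (i == b) || (j == a) then 1%N else 3%N.
    by rewrite /fam_lev Es Cs.
  have [ib|ib] := eqVneq i b.
    have ja : j != a.
      apply: contraTneq Cs => ->; rewrite /pos_C /= ib eqxx leqnn !andbF //.
    by rewrite fam_C_col // GQ fixA ?mul0mx ?mxE ?addr0 // lev ib eqxx.
  rewrite fam_C_row // GQ; have [ja|ja] := eqVneq j a.
    by rewrite fixD ?mulmx0 ?mxE ?addr0 // lev ja eqxx orbT.
  by rewrite D_col0 // addr0.
have l2 : fam_lev s = 2 by rewrite /fam_lev Es Cs.
case As: (pos_A s).
  rewrite /fam_psi Es Cs As.
  case: s Ss hQ fixA fixD fixC Es Cs As l2 => i m /= Ss hQ _ _ fixC Es Cs As l2.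
  case/and3P: (As) => /= /eqP ib nJm wm; have [Jn /andP [bn na] mn] := nuP nJm wm.
  have mb : m != b by apply: gt0; case/andP: wm.
  have l23 : (fam_lev (i, m) < 3)%N by rewrite l2.
  rewrite (fam_entry _ nJb Jn) (fam_C_col _ _ (lta _ na)) (fam_C0_row_b _ (ltnW na)) add0r.
  rewrite mxE (bigD1 m) //= big1 => [|l lm].
    rewrite maskE -{1}ib As addr0 (fixC _ _ l23 mb (lta _ na)).
    by rewrite mxE Jn mn eqxx mulr1 ib.
  rewrite maskE; case: ifP => [/and3P [_ _ /= /andP [bl _]]|]; last by rewrite mul0r.
  by rewrite (fixC _ _ l23 (gt0 _ bl) (lta _ na)) mxE mn (negPf lm) andbF mulr0.
have Ds : pos_D s by move: Ss; rewrite /fam_pos Es Cs As.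
rewrite /fam_psi Es Cs As.
case: s Ss hQ fixA fixD fixC Es Cs As Ds l2 => t j /= Ss hQ _ _ fixC Es Cs As Ds l2.
case/and3P: (Ds) => /= /eqP ja Jt wt; have /andP [nJm _] := mu_lt Jt.
have bm := mu_gt Jt wt.
have l23 : (fam_lev (t, j) < 3)%N by rewrite l2.
have ta : t != a by apply: lta; case/andP: wt.
rewrite (fam_entry _ nJm Ja) (fam_C_row _ _ (gt0 _ bm)) (fam_C0_col_a _ (ltnW bm)) add0r.
rewrite mxE (bigD1 t) //= big1 => [|l lt].
  rewrite [D Q t a]maskE -{1}ja Ds addr0 (fixC _ _ l23 (gt0 _ bm) ta).
  by rewrite mxE Jt eqxx mul1r ja.
rewrite [D Q l a]maskE; case: ifP => [/and3P [_ /= Jl /andP [_ la]]|]; last by rewrite mulr0.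
rewrite (fixC _ _ l23 (gt0 _ bm) (lta _ la)) mxE Jl /=.
case: eqP => [/(mu_inj Jt Jl) e|]; last by rewrite mul0r.
by rewrite e eqxx in lt.
Qed.

Lemma fam_variety Q : \rank (G0 Q) = #|J| ->
  setI (cell_variety K) (cell_variety J) (fam Q).
Proof.
move=> rG; have [_ [hO hS]] := pivot_cell_variety (fam_pivot_cell rG).
split; last exact/pivot_cell_variety/fam_pivot_cell.
split; last by split=> //; rewrite card_pivot_swap.
apply: (@zariski_closure_line _ _ _ _ _ (fam_dir Q)) => t.
exact: fam_line_pivot_cell.
Qed.

Lemma fam_chain :
  irreducible_chain (setI (cell_variety K) (cell_variety J) : set 'M[F]_n) #|fam_pos|.
Proof.
have [L [R LR]] := rank_witness (G0 Q0).
apply: (chain_of_levels (phi := fam) (lev := fam_lev) (psi := fam_psi) (Q0 := Q0)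
  (h := fun Q => \det (L *m G0 Q *m R))).
- exact: poly_fun_fam.
- exact/poly_fun_rank_det/poly_fun_mask.
- by rewrite LR det1 oner_eq0.
- move=> Q /rank_det_neq0 rQ; apply: fam_variety; apply/eqP.
  rewrite eqn_leq (leq_trans rank_base rQ) andbT.
  by rewrite -fam_C0_proj (leq_trans (mxrankM_maxr _ _)) ?rank_proj_le.
- exact: fam_recover.
Qed.

(** Every position lost to the forced zeros, except [(b, a)], is replaced: [tau] sends [(b, j)] to
    [(j, a)] in [pos_D], and [(i, a)] to [(b, i)] in [pos_A]. The map [rho] undoes this. *)
Lemma card_support_fam_pos : (#|cell_support K| <= #|fam_pos|.+1)%N.
Proof.
rewrite card_cell_support card_pivot_swap -card_cell_support.
pose tau (s : 'I_n * 'I_n) := if (s.1 == b) && (b < s.2 < a)%N then (s.2, a) else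
  if (s.2 == a) && (b < s.1 < a)%N then (b, s.1) else s.
rewrite (cardD1 (b, a)) -[X in (_ <= X)%N]add1n leq_add ?leq_b1 //.
have inS (s : 'I_n * 'I_n) : s \in [predD1 cell_support J & (b, a)] ->
    [/\ s != (b, a), ~~ J s.1 & J s.2].
  by rewrite !inE -!topredE => /and3P [].
pose rho (s : 'I_n * 'I_n) := if (s.2 == a) && J s.1 then (b, s.1) else
  if (s.1 == b) && ~~ J s.2 then (s.2, a) else s.
have inj : {in [predD1 cell_support J & (b, a)] &, injective tau}.
  apply: (can_in_inj (g := rho)) => -[i j] /inS [/= _ nJi Jj]; rewrite /tau /=.
  case: ifP => [/andP [/eqP -> _]|_]; first by rewrite /rho /= eqxx Jj.
  case: ifP => [/andP [/eqP -> _]|_].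
    by rewrite /rho /= (negPf nJb) andbF eqxx nJi.
  by rewrite /rho /= (negPf nJi) Jj !andbF.
rewrite -(card_in_image inj); apply: subset_leq_card; apply/fintype.subsetP => x.
move=> /mapP [[i j]]; rewrite mem_enum => /inS /= [ne nJi Jj] ->.
rewrite -topredE /= /tau /fam_pos /=; case: ifP => [/andP [_ wj]|n1].
  by rewrite /pos_D /= eqxx Jj wj !orbT.
case: ifP => [/andP [_ wi]|n2]; first by rewrite /pos_A /= eqxx nJi wi !orbT.
rewrite /pos_N /pos_C /= nJi Jj /=; case: (ltngtP j i) => //= [ij|/val_inj ij]; last first.
  by rewrite ij (negPf nJi) in Jj.
suff -> : ~~ ((i == b) && (j <= a)%N) && ~~ ((j == a) && (b <= i)%N) by [].
apply/andP; split; apply/negP => /andP [/eqP e].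
  rewrite leq_eqVlt => /orP [/eqP /val_inj ja|ja]; first by rewrite e ja eqxx in ne.
  by move: n1; rewrite e eqxx ja -e ij.
rewrite leq_eqVlt => /orP [/eqP /val_inj bi|bi]; first by rewrite e bi eqxx in ne.
by move: n2; rewrite e eqxx bi -e ij.
Qed.

Lemma family_codim :
  has_codim (cell_variety K : set 'M[F]_n) (setI (cell_variety K) (cell_variety J)) 1.
Proof.
apply: codim_one_of_chain card_support_fam_pos _ fam_chain; first by rewrite card_pivot_swap.
have rB : \rank (G0 Q0) = #|J|.
  apply/eqP; rewrite eqn_leq rank_base andbT.
  by rewrite -fam_C0_proj (leq_trans (mxrankM_maxr _ _)) ?rank_proj_le.
exists (fam Q0 + 1 *: fam_dir Q0).
have Kx := fam_line_pivot_cell rB (oner_neq0 F); split=> //.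
(* The first [b.+1] columns include index [b] but not [a], so they contain one more pivot of [K]
   than of [J]. *)
apply: (@pivot_cell_not_in_closure _ _ K J _ b.+1) => //.
apply: proper_card; apply/fintype.properP; split.
  apply/fintype.subsetP => i; rewrite !inE => /andP [Ji ib].
  rewrite /K Ji ib andbT /=; apply/orP; right; apply: contraTneq ib => ->.
  by rewrite -leqNgt.
by exists b; rewrite !inE ?(negPf nJb) // /K eqxx ltnSn.
Qed.

End Family.

(** * Tableaux *)

Section Cycles.
Local Open Scope nat_scope.

Lemma nth_lt_count (s : seq nat) x r : sorted ltn s -> r < size s ->
  (nth 0 s r < x) = (r < count (fun d => d < x) s).
Proof.
move=> ss rs; have mono i j : i < j -> j < size s -> nth 0 s i < nth 0 s j.
  by move=> ij js; apply: (sorted_ltn_nth ltn_trans) => //; rewrite inE (ltn_trans ij).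
apply/idP/idP => [ltx|].
  rewrite -(cat_take_drop r.+1 s) count_cat ltn_addr // -[r in r < _]/(r.+1.-1).
  suff /eqP -> : count (fun d => d < x) (take r.+1 s) == size (take r.+1 s).
    by rewrite size_takel.
  rewrite -all_count; apply/(all_nthP 0) => i; rewrite size_takel // ltnS => ir.
  rewrite nth_take // (leq_ltn_trans _ ltx) //; move: ir; rewrite leq_eqVlt.
  by move=> /orP [/eqP -> //|ir]; rewrite ltnW // mono.
apply: contraTT; rewrite -!leqNgt => xle.
rewrite -(cat_take_drop r s) count_cat.
have /eqP -> : count (fun d => d < x) (drop r s) == 0.
  rewrite -leqn0 leqNgt -has_count; apply/hasPn => y yin.
  have /(nthP 0) h := yin; case: h => i; rewrite size_drop nth_drop => ir <-.
  rewrite -leqNgt (leq_trans xle) //.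
  case: i ir => [|i] ir; rewrite ?addn0 //.
  by apply: ltnW; apply: mono; [lia|rewrite -ltn_subRL].
by rewrite addn0 (leq_trans (count_size _ _)) // size_takel // ltnW.
Qed.

Lemma bigmax_mem (s : seq nat) : s != [::] -> \max_(d <- s) d \in s.
Proof.
elim: s => // x [|y s] IH _; first by rewrite big_seq1 mem_seq1.
rewrite big_cons inE; have {}IH := IH isT.
by case: leqP => _; rewrite ?IH ?orbT // eqxx.
Qed.

(** The counting hypothesis ensures that each maximum runs over a nonempty set and is not the
    default 0. It survives the removal of one element, as the index [r] drops by one too. *)
Lemma next_cyclesP avail bs : uniq avail ->
  (forall r, r < size bs -> r < count (fun d => d < nth 0 bs r) avail) ->
  [/\ unzip2 (next_cycles avail bs) = bs,
      forall c, c \in next_cycles avail bs -> c.1 \in avail /\ c.1 < c.2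
    & uniq (unzip1 (next_cycles avail bs))].
Proof.
elim: bs avail => [|b bs IH] avail ua hc //=.
set i := \max_(d <- avail | d < b) d.
have : i \in [seq d <- avail | d < b].
  rewrite /i -big_filter; apply: bigmax_mem.
  have := hc 0 isT; rewrite -has_count has_filter //.
rewrite mem_filter => /andP [ib ia].
have [||e hm un] := IH (rem i avail) _ _; first exact: rem_uniq.
  move=> r rs; have := hc r.+1 rs; rewrite count_rem ia /=.
  by move: (count _ _) => c; case: (i < _) => /=; lia.
split; first by rewrite e.
  by move=> c; rewrite inE => /orP [/eqP -> //|/hm []]; rewrite mem_rem_uniq // inE => /andP [].
rewrite un andbT; apply/mapP => -[c /hm [cr _] ic].
by move: cr; rewrite -ic mem_rem_uniq // !inE eqxx.
Qed.

Variables (n k : nat) (T : array2).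
Hypothesis hk : 2 * k <= n.
Hypothesis hT : is_tableau n k T.

Lemma tableau_uniq : uniq (T.1 ++ T.2).
Proof. by case: hT => _ _ /perm_uniq -> _ _; apply: iota_uniq. Qed.

Lemma tableau_mem x : (x \in T.1) || (x \in T.2) = (0 < x <= n).
Proof.
case: hT => _ _ /perm_mem h _ _; rewrite -mem_cat h mem_iota add1n.
by rewrite ltnS.
Qed.

Lemma tableau_notin x : x \in T.1 -> x \notin T.2.
Proof.
move=> x1; have := tableau_uniq; rewrite cat_uniq => /and3P [_ /hasPn h _].
by apply/negP => /h; rewrite /= x1.
Qed.

(** The row inequalities of the tableau provide the counts required by [next_cyclesP]. For the first
    cycle, [b.-1] is an entry below the least element of the second column, so it lies in the
    first. *)
Lemma sigmaP :
  [/\ unzip2 (sigma T) = T.2,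
      forall c, c \in sigma T -> c.1 \in T.1 /\ c.1 < c.2
    & uniq (unzip1 (sigma T))].
Proof.
case: (hT) => s1 s2 pT [so1 so2] bal.
have := tableau_uniq; rewrite cat_uniq => /and3P [u1 _ u2].
have hc r : r < size T.2 -> r < count (fun d => d < nth 0 T.2 r) T.1.
  by rewrite s2 => rk; rewrite -nth_lt_count ?bal // s1; lia.
rewrite /sigma; case E2: T.2 => [|b bs]; first by split.
have nbs r : r < size bs -> b < nth 0 bs r.
  move=> rs; have : path ltn b bs by rewrite -[path _ _ _]/(sorted ltn (b :: bs)) -E2.
  by move/(order_path_min ltn_trans)/allP; apply; apply: mem_nth.
have b2 : b \in T.2 by rewrite E2 inE eqxx.
have b1 : b.-1 \in T.1 /\ b.-1 < b.
  have b0 : 1 < b.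
    have := hc 0; rewrite E2 => /(_ isT) /=; rewrite -has_count => /hasP [d d1 db].
    have : 0 < d <= n by rewrite -tableau_mem d1.
    by case/andP => d0 _; apply: leq_ltn_trans db.
  split; last by rewrite prednK // ltnW.
  have : (b.-1 \in T.1) || (b.-1 \in T.2).
    have : 0 < b <= n by rewrite -tableau_mem b2 orbT.
    by rewrite tableau_mem; lia.
  case/orP => //; rewrite E2 inE => /orP [/eqP e|/(nthP 0) [r rs e]]; first by lia.
  by have := nbs r rs; rewrite e; lia.
case: b1 => b1 b1b.
have [||e hm un] := @next_cyclesP (rem b.-1 T.1) bs.
- exact: rem_uniq.
- move=> r rs; have := hc r.+1; rewrite E2 => /(_ rs) /=; rewrite count_rem b1 /=.
  by move: (count _ _) => c; case: (b.-1 < _) => /=; lia.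
split; first by rewrite /= e.
  move=> c; rewrite inE => /orP [/eqP -> //|/hm []].
  by rewrite mem_rem_uniq // inE => /andP [].
rewrite /= un andbT; apply/mapP => -[c /hm [cr _] ic].
by move: cr; rewrite -ic mem_rem_uniq // !inE eqxx.
Qed.

(* The first entry of the cycle of sigma T that contains s. *)
Definition partner s := (nth (0, 0) (sigma T) (index s T.2)).1.

Lemma partner_cycle s : s \in T.2 -> (partner s, s) \in sigma T.
Proof.
have [e _ _] := sigmaP; move=> s2.
have sz : index s T.2 < size (sigma T) by rewrite -(size_map snd) -/unzip2 e index_mem.
have : nth (0, 0) (sigma T) (index s T.2) \in sigma T by apply: mem_nth.
rewrite /partner; have : (nth (0, 0) (sigma T) (index s T.2)).2 = s.
  by rewrite -(nth_map _ 0) // -/unzip2 e nth_index.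
by case: (nth _ _ _) => x y /= ->.
Qed.

Lemma cycle_partner c : c \in sigma T -> c.2 \in T.2 /\ c.1 = partner c.2.
Proof.
have [e _ _] := sigmaP; have := tableau_uniq; rewrite cat_uniq => /and3P [_ _ u2].
move=> /(nthP (0, 0)) [j js <-].
have e2 : (nth (0, 0) (sigma T) j).2 = nth 0 T.2 j.
  by rewrite -(nth_map _ 0) // -/unzip2 e.
have j2 : j < size T.2 by rewrite -e size_map.
by rewrite e2 /partner index_uniq // mem_nth.
Qed.

Lemma partner_lt s : s \in T.2 -> partner s \in T.1 /\ partner s < s.
Proof. by have [_ h _] := sigmaP; move=> /partner_cycle /h. Qed.

Lemma partner_inj : {in T.2 &, injective partner}.
Proof.
have [_ _ un] := sigmaP; move=> s s' /partner_cycle hs /partner_cycle hs' e.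
move: hs hs' => /(nthP (0, 0)) [i iz ei] /(nthP (0, 0)) [j jz ej].
have : i = j.
  apply/eqP; rewrite -(@nth_uniq _ 0 (unzip1 (sigma T))) ?size_map //.
  by rewrite !(nth_map (0, 0)) // ei ej /= e.
by move=> ij; move: ej; rewrite -ij ei => -[].
Qed.

Variables (a b : nat).
Hypothesis ha : a \in T.1.
Hypothesis hb : Bset T a b.

Lemma Bset_mem : b \in T.2 /\ b < a.
Proof. by case: hb => p [ps -> ? _]; split=> //; apply: mem_nth. Qed.

(** The entries strictly between [b] and [a] are a union of whole cycles; if [b = a.-1] there are
    none. *)
Lemma partner_between s : s \in T.2 -> b < s < a -> b < partner s.
Proof.
move=> s2 bsa; case: hb => p [ps _ _ [ba|/seteqP [h1 h2]]]; first by lia.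
have /h1 [c cd /= e] : b.+1 <= s <= a.-1 by lia.
have [c2 c1] := cycle_partner (mem_drop cd).
have sc : s = c.2.
  case: e => // e; have [/tableau_notin] := partner_lt c2.
  by rewrite -c1 -e s2.
suff /h2 /= : exists2 c', c' \in drop p.+1 (sigma T) & partner s = c'.1 \/ partner s = c'.2.
  by case/andP.
by exists c => //; left; rewrite c1 sc.
Qed.

Lemma between_partner m : m \in T.1 -> b < m < a ->
  exists s, [/\ s \in T.2, b < s < a & partner s = m].
Proof.
move=> m1 bma; case: hb => p [ps _ _ [ba|/seteqP [h1 h2]]]; first by lia.
have /h1 [c cd /= e] : b.+1 <= m <= a.-1 by lia.
have [c2 c1] := cycle_partner (mem_drop cd).
have mc : m = c.1.
  by case: e => // e; have := tableau_notin m1; rewrite e c2.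
exists c.2; split=> //; last by rewrite mc c1.
suff /h2 /andP [-> h] : exists2 c', c' \in drop p.+1 (sigma T) & c.2 = c'.1 \/ c.2 = c'.2.
  by rewrite (leq_ltn_trans h) // ltn_predL; lia.
by exists c => //; right.
Qed.

Local Notation T' := (Change T a b).

Lemma Change_mem1 x : (x \in T'.1) = (x == b) || (x \in T.1) && (x != a).
Proof.
have := tableau_uniq; rewrite cat_uniq => /and3P [u1 _ _].
by rewrite mem_sort inE mem_rem_uniq // inE andbC.
Qed.

Lemma Change_mem2 x : (x \in T'.2) = (x == a) || (x \in T.2) && (x != b).
Proof.
have := tableau_uniq; rewrite cat_uniq => /and3P [_ _ u2].
by rewrite mem_sort inE mem_rem_uniq // inE andbC.
Qed.

Definition swap_ab x := if x == a then b else if x == b then a else x.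
(* Conjugating sigma T by the transposition (a b) gives a matching for T'. *)
Definition new_partner s := swap_ab (partner (swap_ab s)).

Lemma swapK : involutive swap_ab.
Proof.
move=> x; rewrite /swap_ab; have [->|xa] := eqVneq x a.
  by have [->|_] := eqVneq b a; rewrite ?eqxx.
by have [->|xb] := eqVneq x b; rewrite ?eqxx // (negPf xa) (negPf xb).
Qed.

Lemma swap_mem s : s \in T'.2 -> swap_ab s \in T.2.
Proof.
have [b2 ba] := Bset_mem; rewrite Change_mem2 /swap_ab => /orP [/eqP ->|/andP [s2 sb]].
  by rewrite eqxx.
by case: eqP => // _; rewrite (negPf sb).
Qed.

(** The cycle ending at [b] now ends at [a], and a cycle starting at [a], if any, now starts at [b].
    As [b < a], both only become wider. *)
Lemma new_partner_lt s : s \in T'.2 -> new_partner s \in T'.1 /\ new_partner s < s.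
Proof.
move=> s2; have [p1 ps] := partner_lt (swap_mem s2).
have [b2 ba] := Bset_mem.
have pb : partner (swap_ab s) != b.
  by apply: contraTneq b2 => <-; apply: tableau_notin.
set q := partner (swap_ab s) in ps p1 pb.
have sq : swap_ab q = if q == a then b else q by rewrite /swap_ab (negPf pb).
rewrite Change_mem1 /new_partner -/q sq.
move: (s2); rewrite Change_mem2 => /orP [/eqP sa|/andP [s2' sb]].
  have qb : q < b by move: ps; rewrite /swap_ab sa eqxx.
  have qa : q != a by lia.
  by rewrite (negPf qa) p1 qa orbT; split=> //; lia.
have sa : s != a by apply: contraTneq s2' => ->; apply: tableau_notin.
have qs : q < s by move: ps; rewrite /swap_ab (negPf sa) (negPf sb).
have [qa|qa] := eqVneq q a; first by rewrite eqxx; split=> //; lia.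
by rewrite p1 qa orbT.
Qed.

Lemma new_partner_inj : {in T'.2 &, injective new_partner}.
Proof.
move=> s s' hs hs' /(can_inj swapK) /partner_inj e.
by apply: (can_inj swapK); apply: e; apply: swap_mem.
Qed.

Lemma new_partner_a : new_partner a < b.
Proof.
have [b2 ba] := Bset_mem; have [_] := partner_lt b2.
rewrite /new_partner /swap_ab eqxx => pb.
have /negPf -> : partner b != a by lia.
by have /negPf -> : partner b != b by lia.
Qed.

Lemma new_partner_id s : s \in T.2 -> b < s < a -> new_partner s = partner s.
Proof.
move=> s2 bsa; have [_ ps] := partner_lt s2; have bp := partner_between s2 bsa.
rewrite /new_partner /swap_ab.
have /negPf -> : s != a by lia.
have /negPf -> : s != b by lia.
have /negPf -> : partner s != a by lia.
by have /negPf -> : partner s != b by lia.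
Qed.

Lemma Change_uniq : uniq T'.1 /\ uniq T'.2.
Proof.
have := tableau_uniq; rewrite cat_uniq => /and3P [u1 _ u2].
have [b2 ba] := Bset_mem.
rewrite !sort_uniq /= !rem_uniq // !mem_rem_uniq // !inE !andbT !negb_and.
split; apply/orP; right; last exact: tableau_notin.
by apply/negP => /tableau_notin; rewrite b2.
Qed.

Lemma sort_ltn_sorted (s : seq nat) : uniq s -> sorted ltn (sort leq s).
Proof.
by move=> us; rewrite ltn_sorted_uniq_leq sort_uniq us sort_sorted //; apply: leq_total.
Qed.

(** The first [r.+1] entries of the second column have distinct partners in the first column, all
    below the entry in row [r]; by [nth_lt_count] this is the row inequality. *)
Lemma Change_tableau : is_tableau n k T'.
Proof.
case: (hT) => s1 s2 pT _ _; have [b2 ba] := Bset_mem; have [u1' u2'] := Change_uniq.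
have z1 : size T'.1 = n - k.
  by rewrite size_sort /= size_rem // s1 prednK // -s1; case: T.1 ha.
have z2 : size T'.2 = k.
  by rewrite size_sort /= size_rem // s2 prednK // -s2; case: T.2 b2.
have so1 : sorted ltn T'.1 by apply: sort_ltn_sorted; rewrite -(sort_uniq leq).
have so2 : sorted ltn T'.2 by apply: sort_ltn_sorted; rewrite -(sort_uniq leq).
split=> //.
  apply: perm_trans pT; apply/permP => q.
  rewrite !count_cat !(permP (permEl (perm_sort _ _))) /= !count_rem ha b2 /=.
  have c1 : q a <= count q T.1 by rewrite (permP (perm_to_rem ha)) /= leq_addr.
  have c2 : q b <= count q T.2 by rewrite (permP (perm_to_rem b2)) /= leq_addr.
  move: c1 c2; move: (count q T.1) (count q T.2) (nat_of_bool (q a)) (nat_of_bool (q b)).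
  by move=> *; lia.
move=> r rk; rewrite nth_lt_count //; last by rewrite z1; lia.
set s := nth 0 T'.2 r.
have -> : r.+1 = size [seq new_partner x | x <- take r.+1 T'.2].
  by rewrite size_map size_takel // z2.
rewrite -size_filter; apply: uniq_leq_size.
  rewrite map_inj_in_uniq ?take_uniq // => x y /mem_take hx /mem_take hy.
  exact: new_partner_inj.
move=> _ /mapP [x xr ->]; rewrite mem_filter.
have [m1 lt] := new_partner_lt (mem_take xr); rewrite m1 andbT (leq_trans lt) //.
have /(nthP 0) h := xr; case: h => i; rewrite size_takel ?z2 // ltnS => ir.
rewrite nth_take // => <-; move: ir; rewrite leq_eqVlt => /orP [/eqP -> //|ir].
rewrite ltnW //; apply: (sorted_ltn_nth ltn_trans) => //; rewrite inE z2 //.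
exact: ltn_trans rk.
Qed.

End Cycles.

(** * Orbital varieties in terms of pivot sets *)

Definition pivots n (T : array2) : pred 'I_n := fun i => i.+1 \in T.2.

(** In a strictly upper matrix the first [m] columns vanish from row [m] on, so they have the rank
    of the corner block. *)
Lemma rank_corner (F : fieldType) n m (hm : (m <= n)%N) (x : 'M[F]_n) :
  strictly_upper x ->
  \rank (mxsub (widen_ord hm) (widen_ord hm) x) = \rank (x *m pid_mx m : 'M_n).
Proof.
move=> sx; set y := mxsub _ _ x.
pose e : 'M[F]_(n, m) := \matrix_(i, j) (i == widen_ord hm j)%:R.
have eE i j : e i j = (val i == val j)%:R by rewrite mxE -val_eqE.
have eTE i j : e^T i j = (val j == val i)%:R by rewrite mxE eE.
have eyE : x *m pid_mx m = e *m y *m e^T :> 'M_n.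
  apply/matrixP => i j; rewrite mul_mx_pid mxE.
  case: (ltnP j m) => jm; last first.
    rewrite big1 // => l _; rewrite eTE gtn_eqF ?mulr0 //.
    exact: leq_trans (ltn_ord l) jm.
  rewrite (bigD1 (Ordinal jm)) //= eTE eqxx mulr1 [X in _ + X]big1 ?addr0 => [|l lj]; last first.
    by rewrite eTE eq_sym [_ == _](negPf lj) mulr0.
  rewrite mxE; case: (ltnP i m) => im.
    rewrite (bigD1 (Ordinal im)) //= big1 => [|l li].
      by rewrite eE eqxx mul1r addr0 mxE; congr (x _ _); apply/val_inj.
    by rewrite eE eq_sym [_ == _](negPf li) mul0r.
  rewrite big1 ?sx // => [|l _]; first by rewrite (leq_trans _ im) // ltnW.
  by rewrite eE gtn_eqF ?mul0r // (leq_trans (ltn_ord l)).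
have ee : e^T *m e = 1%:M.
  apply/matrixP => i j; rewrite !mxE (bigD1 (widen_ord hm i)) //= big1 => [|l li].
    by rewrite !mxE eqxx mul1r addr0 -!val_eqE.
  by rewrite !mxE (negPf li) mul0r.
have yE : y = e^T *m (x *m pid_mx m) *m e.
  by rewrite eyE !mulmxA ee mul1mx -mulmxA ee mulmx1.
apply/eqP; rewrite eqn_leq; apply/andP; split.
  by rewrite {1}yE (leq_trans (mxrankM_maxl _ _)) ?mxrankM_maxr.
by rewrite eyE (leq_trans (mxrankM_maxl _ _)) ?mxrankM_maxr.
Qed.

Section Link.
Variables (n k : nat) (T : array2).
Hypothesis hT : is_tableau n k T.

Lemma card_pivots_lt m : (m <= n)%N ->
  #|[pred i : 'I_n | pivots T i && (i < m)%N]| = count (fun b => (b <= m)%N) T.2.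
Proof.
move=> mn; have := tableau_uniq hT; rewrite cat_uniq => /and3P [_ _ u2].
rewrite -size_filter cardE -(size_map (fun i : 'I_n => i.+1)).
apply/perm_size/uniq_perm.
- by rewrite map_inj_uniq ?enum_uniq // => i j [] /val_inj.
- exact: filter_uniq.
move=> x; rewrite mem_filter; apply/mapP/andP => [[l]|[xm x2]].
  by rewrite mem_enum inE => /andP [pl lm] ->.
have : (0 < x <= n)%N by rewrite -(tableau_mem hT) x2 orbT.
move=> /andP [x0 xn]; have xn' : (x.-1 < n)%N by rewrite prednK.
exists (Ordinal xn') => /=; last by rewrite prednK.
by rewrite mem_enum inE /pivots /= prednK // x2.
Qed.

Lemma card_pivots : #|@pivots n T| = k.
Proof.
case: (hT) => _ s2 _ _ _; rewrite -s2 -(count_predT T.2).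
transitivity (count (fun b => (b <= n)%N) T.2); last first.
  apply: eq_in_count => b b2; have : (0 < b <= n)%N by rewrite -(tableau_mem hT) b2 orbT.
  by case/andP.
rewrite -card_pivots_lt //; apply: eq_card => i.
by rewrite !inE ltn_ord andbT.
Qed.

Lemma orbital_variety_pivots (F : fieldType) :
  orbital_variety F n k T = setI (zariski_closure (pivot_cell (@pivots n T)))
    (setI (nilp_orbit k) (@strictly_upper F n)).
Proof.
rewrite /orbital_variety; congr (setI (zariski_closure _) _).
apply/seteqP; split=> x.
  move=> [] [] [xx rx] sx hx; split=> //; first by rewrite card_pivots.
  by move=> m mn; rewrite card_pivots_lt // -hx rank_corner.
move=> [sx xx rx hx]; split; first by split=> //; split=> //; rewrite rx card_pivots.
by move=> m mn; rewrite rank_corner // hx // card_pivots_lt.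
Qed.

End Link.

Local Close Scope ring_scope.

Theorem proposition4p5 (R : realType) (n k : nat) (T : array2) (a b : nat)
    (hk : 2 * k <= n) (hT : is_tableau n k T)
    (ha : a \in T.1) (ha' : a.-1 \in T.2) (hb : Bset T a b) :
  is_tableau n k (Change T a b) /\
  has_codim
    (orbital_variety (complex R) n k T)
    (setI (orbital_variety (complex R) n k T)
          (orbital_variety (complex R) n k (Change T a b)))
    1.
Proof.
have hT' := Change_tableau hk hT ha hb; split=> //.
have [b2 ba] := Bset_mem hb.
have an : 0 < a <= n by rewrite -(tableau_mem hT) ha.
have bn : 0 < b <= n by rewrite -(tableau_mem hT) b2 orbT.
(* Tableau entries start at 1 and matrix indices at 0, whence the shift. *)
have ao_n : a.-1 < n by lia.
have bo_n : b.-1 < n by lia.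
pose ao := Ordinal ao_n; pose bo := Ordinal bo_n.
have aoE : ao.+1 = a by rewrite /=; lia.
have boE : bo.+1 = b by rewrite /=; lia.
pose J := @pivots n (Change T a b).
have eq_ao (i : 'I_n) : (i == ao) = (i.+1 == a) by rewrite -aoE eqSS.
have eq_bo (i : 'I_n) : (i == bo) = (i.+1 == b) by rewrite -boE eqSS.
have JE i : J i = (i.+1 == a) || (i.+1 \in T.2) && (i.+1 != b).
  exact: (Change_mem2 hT a b).
have nJE i : ~~ J i = (i.+1 \in (Change T a b).1).
  have := tableau_mem hT' i.+1; rewrite ltn_ord /J /pivots.
  have := @tableau_notin _ _ _ hT' i.+1.
  by case: (_ \in (Change T a b).1) => [/(_ isT) ->//|_ /= ->].
have KE : @pivots n T = pivot_swap J ao bo.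
  apply/funext => i; rewrite /pivot_swap JE eq_ao eq_bo /pivots.
  have [->|ib] := eqVneq i.+1 b; first by rewrite b2.
  have [ia|ia] := eqVneq i.+1 a; last by rewrite /= !andbT.
  by rewrite ia (negPf (tableau_notin hT ha)).
(* Outside [J] the value is irrelevant, and [i] serves as a default. *)
have exmu (i : 'I_n) : exists m : 'I_n, J i -> m.+1 = new_partner T a b i.+1.
  case Ji: (J i); last by exists i.
  have [p1 p2] := new_partner_lt hk hT ha hb Ji.
  have pn : 0 < new_partner T a b i.+1 <= n by rewrite -(tableau_mem hT') p1.
  have pn' : (new_partner T a b i.+1).-1 < n by lia.
  by exists (Ordinal pn') => _ /=; lia.
have [mu muE] := choice exmu.
have exnu (m : 'I_n) : exists x : 'I_n, ~~ J m -> bo < m < ao ->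
    [/\ J x, bo < x < ao & mu x = m].
  case: (boolP (~~ J m && (bo < m < ao))) => [/andP [nJm bma]|h]; last first.
    by exists m => h1 h2; rewrite h1 h2 in h.
  have bma' : b < m.+1 < a by rewrite -aoE -boE !ltnS.
  have m1 : m.+1 \in T.1.
    move: nJm; rewrite nJE (Change_mem1 hT) => /orP [/eqP e|/andP [] //].
    by rewrite e ltnn in bma'.
  have [s [s2 bsa ps]] := between_partner hk hT ha hb m1 bma'.
  have sn : s.-1 < n.
    by have : 0 < s <= n; [rewrite -(tableau_mem hT) s2 orbT|lia].
  have sE : (Ordinal sn).+1 = s by rewrite /=; lia.
  have Js : J (Ordinal sn).
    by rewrite JE sE s2; apply/orP; right; apply/andP; split=> //; lia.
  have mu_sn : mu (Ordinal sn) = m.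
    apply/val_inj/succn_inj; rewrite (muE _ Js) sE.
    by rewrite (new_partner_id hk hT ha hb s2 bsa).
  by exists (Ordinal sn) => _ _; split=> //=; lia.
have [nu nuP] := choice exnu.
have codim : has_codim (cell_variety (pivot_swap J ao bo) : set 'M[complex R]_n)
    (setI (cell_variety (pivot_swap J ao bo)) (cell_variety J)) 1.
  apply: (@family_codim _ n J ao bo mu nu).
  - by rewrite -ltnS aoE boE.
  - by rewrite JE aoE eqxx.
  - by rewrite nJE (Change_mem1 hT) boE eqxx.
  - move=> s Js; have [p1 p2] := new_partner_lt hk hT ha hb Js.
    by rewrite nJE (muE _ Js) p1.
  - move=> s s' Js Js' /(congr1 (fun i : 'I_n => i.+1)).
    by rewrite (muE _ Js) (muE _ Js') => /(new_partner_inj hk hT hb Js Js') [] /val_inj.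
  - have Ja : J ao by rewrite JE aoE eqxx.
    by rewrite -ltnS (muE _ Ja) aoE boE; exact: (new_partner_a hk hT ha hb).
  - move=> s Js bsa; have bsa' : b < s.+1 < a by rewrite -aoE -boE !ltnS.
    have s2 : s.+1 \in T.2.
      by move: Js; rewrite JE => /orP [/eqP e|/andP [] //]; rewrite e ltnn andbF in bsa'.
    rewrite -ltnS (muE _ Js) boE (new_partner_id hk hT ha hb) //.
    exact: (partner_between hk hT ha hb s2 bsa').
  - exact: nuP.
have cK : #|pivot_swap J ao bo| = k by rewrite -KE (card_pivots hT).
have cJ : #|J| = k := card_pivots hT'.
rewrite (orbital_variety_pivots hT) (orbital_variety_pivots hT') KE.
by move: codim; rewrite /cell_variety cK cJ.
Qed.
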